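(* Let $A\subseteq\mathbb{N}$ and let $S_A:=\{(n,\top)\mid n\in A\}\cup\{(n,\bot)\mid n\notin A\}$, regarded as a subspace of $\mathbb{N}\times\mathbb{S}$. The following are equivalent: (1) $S_A$ computably embeds into $[0,1]^\omega$. (2) $S_A$ is computably normal. (3) $A$ is in the first level of the difference hierarchy over $\Sigma_1$, i.e. $A$ is $2$-c.e.: $A=B\setminus C$ for some computably enumerable sets $B,C\subseteq\mathbb{N}$.
   Context: A represented space $\mathbf{X}=(X,\delta_{\mathbf{X}})$ is a set $X$ with a partial surjection $\delta_{\mathbf{X}}:\subseteq\mathbb{N}^{\mathbb{N}}\to X$; any $p$ with $\delta_{\mathbf X}(p)=x$ is a name of $x$. A subspace is a subset with the restricted representation (a point keeps all its names). A partial multi-valued map $F:\subseteq\mathbf{X}\rightrightarrows\mathbf{Y}$ is a relation $F\subseteq\mathbf X\times\mathbf Y$, with $F(x)=\{y\mid(x,y)\in F\}$ and $\operatorname{dom}(F)=\{x\mid F(x)\neq\emptyset\}$; a realiser of $F$ is a partial map on $\mathbb{N}^{\mathbb{N}}$ sending every name of every $x\in\operatorname{dom}(F)$ to a name of some element of $F(x)$. $F$ is computable (continuously realisable) if it has a computable (continuous) realiser. Single-valued maps are a special case. $\mathbb{N}$ is represented by $\delta_{\mathbb N}(p)=p(0)$. $\mathbf{Y}^{\mathbf{X}}$ is the represented space of total single-valued continuously realisable functions; a name of $f$ is a $p\in\mathbb N^{\mathbb N}$ coding a realiser of $f$, with $p(0)$ the index of a Turing machine using the oracle $n\mapsto p(n+1)$.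 In the product $\mathbf{X}\times\mathbf{Y}$, $p$ names $(x,y)$ iff $n\mapsto p(2n)$ names $x$ and $n\mapsto p(2n+1)$ names $y$. Sierpinski space $\mathbb{S}=\{\top,\bot\}$ is represented so that $0^\omega$ names $\bot$ and every other sequence names $\top$. The space $\mathcal{O}(\mathbf{X})$ of open sets is $\mathbb{S}^{\mathbf{X}}$, identifying $U$ with its characteristic function ($x\mapsto\top$ iff $x\in U$). The space $\mathcal{A}(\mathbf{X})$ consists of the complements of open sets, a name of a closed set being a name of its complement in $\mathcal{O}(\mathbf{X})$. $\mathbf{X}$ computably embeds into $\mathbf{Y}$ if there is a computable injection $i:\mathbf{X}\to\mathbf{Y}$ such that $i^{-1}:i(\mathbf{X})\to\mathbf{X}$ is computable on the subspace $i(\mathbf{X})$ of $\mathbf{Y}$. The Hilbert cube $[0,1]^\omega$ carries its standard representation (sequences of fast rational Cauchy names). $\mathbf{X}$ is computably normal if the multi-valued map $\operatorname{Norm}:\subseteq\mathcal{A}(\mathbf{X})^2\rightrightarrows\mathcal{O}(\mathbf{X})^2$ is computable, where $(A,B)\in\operatorname{dom}(\operatorname{Norm})$ iff $A\cap B=\emptyset$, and $(U,V)\in\operatorname{Norm}(A,B)$ iff $U\cap V=\emptyset$, $A\subseteq U$ and $B\subseteq V$. *)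

(* Defs.v *)
From Stdlib Require Import Reals Lra Lia Arith Cantor.
From Stdlib Require Import Classical ClassicalEpsilon.
From Stdlib Require Import FunctionalExtensionality PropExtensionality ProofIrrelevance.

Set Implicit Arguments.
Unset Strict Implicit.

(** * Oracle computability

    Programs for the partial recursive functions relative to an oracle, in the
    unary presentation: several arguments are passed through the Cantor
    pairing.  These compute exactly the partial functions computed by oracle
    Turing machines, and [encode] is an acceptable (Goedel) numbering. *)

Notation baire := (nat -> nat).

Inductive code : Set :=
| Zero | Succ | Fst | Snd | Oracle
| Pair (a b : code)
| Comp (a b : code)
| Prec (a b : code)
| Mu (a : code).

(** [ev o c x y]: program [c] with oracle [o] halts on input [x] with output [y].
    [Prec a b] is recursion on [k] in [(u, k)]: from [a u], by steps
    [b (u, (k, r))].  [Mu a] looks for the least [y] with [a (x, y) = 0],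
    and diverges if an earlier [a (x, k)] diverges. *)
Fixpoint ev (o : baire) (c : code) : nat -> nat -> Prop :=
  match c with
  | Zero => fun _ y => y = 0
  | Succ => fun x y => y = S x
  | Fst => fun x y => y = fst (of_nat x)
  | Snd => fun x y => y = snd (of_nat x)
  | Oracle => fun x y => y = o x
  | Pair a b => fun x y => exists u v, ev o a x u /\ ev o b x v /\ y = to_nat (u, v)
  | Comp a b => fun x y => exists z, ev o b x z /\ ev o a z y
  | Prec a b => fun x =>
      let u := fst (of_nat x) in
      (fix rec (n : nat) : nat -> Prop :=
         match n with
         | 0 => ev o a u
         | S k => fun y => exists r, rec k r /\ ev o b (to_nat (u, to_nat (k, r))) y
         end) (snd (of_nat x))
  | Mu a => fun x y =>
      ev o a (to_nat (x, y)) 0 /\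
      forall k, k < y -> exists v, ev o a (to_nat (x, k)) (S v)
  end.

Fixpoint encode (c : code) : nat :=
  match c with
  | Zero => 0 | Succ => 1 | Fst => 2 | Snd => 3 | Oracle => 4
  | Pair a b => 5 + 4 * to_nat (encode a, encode b)
  | Comp a b => 6 + 4 * to_nat (encode a, encode b)
  | Prec a b => 7 + 4 * to_nat (encode a, encode b)
  | Mu a => 8 + 4 * encode a
  end.

Lemma to_nat_inj a b c d : to_nat (a, b) = to_nat (c, d) -> a = c /\ b = d.
Proof.
  intro H. apply (f_equal of_nat) in H. rewrite !cancel_of_to in H.
  now inversion H.
Qed.

Lemma encode_inj c d : encode c = encode d -> c = d.
Proof.
  revert d.
  induction c as [ | | | | |a IHa b IHb|a IHa b IHb|a IHa b IHb|a IHa];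
    destruct d; cbn [encode]; intro H; try reflexivity; try lia.
  1-3: match type of H with _ + 4 * ?x = _ + 4 * ?y => assert (H' : x = y) by lia end;
    apply to_nat_inj in H'; destruct H' as [H1 H2];
    now rewrite (IHa _ H1), (IHb _ H2).
  rewrite (IHa d); [reflexivity | lia].
Qed.

Lemma ev_fun o c : forall x y z, ev o c x y -> ev o c x z -> y = z.
Proof.
  induction c as [ | | | | |a IHa b IHb|a IHa b IHb|a IHa b IHb|a IHa];
    cbn [ev]; intros x y z; try congruence.
  - intros (u & v & H1 & H2 & ->) (u' & v' & H3 & H4 & ->).
    now rewrite (IHa _ _ _ H1 H3), (IHb _ _ _ H2 H4).
  - intros (u & H1 & H2) (v & H3 & H4).
    rewrite (IHb _ _ _ H1 H3) in H2. exact (IHa _ _ _ H2 H4).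
  - revert y z. cbv zeta. generalize (snd (of_nat x)) as n.
    induction n as [|n IHn]; intros y z.
    + apply IHa.
    + intros (r & H1 & H2) (s & H3 & H4).
      rewrite (IHn _ _ H1 H3) in H2. exact (IHb _ _ _ H2 H4).
  - intros [H1 H2] [H3 H4].
    destruct (lt_eq_lt_dec y z) as [[H|H]|H]; trivial.
    + destruct (H4 _ H) as [v Hv]. discriminate (IHa _ _ _ H1 Hv).
    + destruct (H2 _ H) as [v Hv]. discriminate (IHa _ _ _ H3 Hv).
Qed.

(** Domain of a partial computable function; the oracle is trivial. *)
Definition ce (B : nat -> Prop) : Prop :=
  exists c, forall n, B n <-> exists y, ev (fun _ => 0) c n y.

(** * Partial maps on Baire space *)

Record pmap := {
  pgraph :> baire -> baire -> Prop;
  pgraph_fun : forall p q r, pgraph p q -> pgraph p r -> q = r }.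

Definition agree (k : nat) (p q : baire) : Prop := forall i, i < k -> p i = q i.

(** Continuity on the domain, for the subspace topology. *)
Definition pmap_continuous (G : pmap) : Prop :=
  forall p q, G p q -> forall n, exists k, forall p' q',
    G p' q' -> agree k p p' -> agree n q q'.

Definition pmap_computable (G : pmap) : Prop :=
  exists c, forall p q, G p q -> forall n, ev p c n (q n).

Definition evens (p : baire) : baire := fun n => p (2 * n).
Definition odds (p : baire) : baire := fun n => p (2 * n + 1).

Definition join (p q : baire) : baire :=
  fun n => if Nat.even n then p (Nat.div2 n) else q (Nat.div2 n).

(** The partial map coded by [p]: [p 0] is the index of a machine, whose input
    [q] and oracle [n |-> p (n + 1)] are presented as one joined oracle. *)
Definition coded_graph (p q r : baire) : Prop :=
  exists c, p 0 = encode c /\ forall n, ev (join (fun m => p (S m)) q) c n (r n).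

Lemma coded_fun p q r s : coded_graph p q r -> coded_graph p q s -> r = s.
Proof.
  intros (c & Hc & H) (d & Hd & H'). rewrite Hc in Hd. apply encode_inj in Hd.
  subst d. apply functional_extensionality. intro n. exact (ev_fun (H n) (H' n)).
Qed.

Definition coded (p : baire) : pmap :=
  {| pgraph := coded_graph p; pgraph_fun := coded_fun (p := p) |}.

(** * Represented spaces *)

Record repspace := {
  pt :> Type;
  names : baire -> pt -> Prop;
  names_fun : forall p x y, names p x -> names p y -> x = y;
  names_surj : forall x, exists p, names p x }.

Definition mvmap (X Y : repspace) := X -> Y -> Prop.

Definition dom (X Y : repspace) (F : mvmap X Y) (x : X) : Prop := exists y, F x y.

Definition realiser (X Y : repspace) (G : pmap) (F : mvmap X Y) : Prop :=
  forall x p, dom F x -> names p x -> exists q y, G p q /\ F x y /\ names q y.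

Definition computable (X Y : repspace) (F : mvmap X Y) : Prop :=
  exists G, pmap_computable G /\ realiser G F.

Definition continuously_realisable (X Y : repspace) (F : mvmap X Y) : Prop :=
  exists G, pmap_continuous G /\ realiser G F.

Definition single (X Y : repspace) (f : X -> Y) : mvmap X Y := fun x y => f x = y.

Definition subspace (X : repspace) (P : X -> Prop) : repspace.
Proof.
  refine {| pt := {x : X | P x}; names := fun p x => names p (proj1_sig x) |}.
  - intros p [x Hx] [y Hy] H1 H2. cbn in *. pose proof (names_fun H1 H2). subst y.
    f_equal. apply proof_irrelevance.
  - intros [x Hx]. exact (names_surj x).
Defined.

Lemma evens_join p q : evens (join p q) = p.
Proof.
  apply functional_extensionality. intro n. unfold evens, join.
  now rewrite Nat.even_even, Nat.div2_double.
Qed.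

Lemma odds_join p q : odds (join p q) = q.
Proof.
  apply functional_extensionality. intro n. unfold odds, join.
  rewrite Nat.even_odd, Nat.add_1_r, Nat.div2_succ_double. reflexivity.
Qed.

Definition prod_space (X Y : repspace) : repspace.
Proof.
  refine {| pt := (X * Y)%type;
            names := fun p z => names (evens p) (fst z) /\ names (odds p) (snd z) |}.
  - intros p [x y] [x' y'] [H1 H2] [H3 H4]. cbn in *.
    now rewrite (names_fun H1 H3), (names_fun H2 H4).
  - intros [x y]. destruct (names_surj x) as [p Hp], (names_surj y) as [q Hq].
    exists (join p q). now rewrite evens_join, odds_join.
Defined.

(** Names of a sequence are sequences of names, along the Cantor pairing. *)
Definition omega_power (X : repspace) : repspace.
Proof.
  refine {| pt := nat -> X;
            names := fun p x => forall i, names (fun j => p (to_nat (i, j))) (x i) |}.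
  - intros p x y H1 H2. apply functional_extensionality. intro i.
    exact (names_fun (H1 i) (H2 i)).
  - intro x.
    exists (fun n => proj1_sig (constructive_indefinite_description _
              (names_surj (x (fst (of_nat n))))) (snd (of_nat n))).
    intro i.
    match goal with |- names ?q _ =>
      replace q with (proj1_sig (constructive_indefinite_description _
                                   (names_surj (x i)))) end.
    + apply proj2_sig.
    + apply functional_extensionality. intro j. now rewrite cancel_of_to.
Defined.

Definition nat_space : repspace.
Proof.
  refine {| pt := nat; names := fun p n => p 0 = n |}.
  - congruence.
  - intro n. now exists (fun _ => n).
Defined.

Inductive sierpinski : Set := top | bot.

Definition sierp : repspace.
Proof.
  refine {| pt := sierpinski;
            names := fun p s => match s with
                                | bot => forall n, p n = 0
                                | top => ~ forall n, p n = 0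
                                end |}.
  - now intros p [] [].
  - intros [].
    + exists (fun _ => 1). intro H. discriminate (H 0).
    + now exists (fun _ => 0).
Defined.

(** * Real numbers and the Hilbert cube *)

Definition rational (m : nat) : R :=
  let (d, c) := of_nat m in
  let (a, b) := of_nat d in
  ((INR a - INR b) / INR (S c))%R.

Lemma pow2_inv_small (e : R) : (0 < e)%R -> exists n, (/ 2 ^ n < e)%R.
Proof.
  intro He.
  destruct (pow_lt_1_zero (/ 2)%R) with (y := e) as [N HN]; trivial.
  - rewrite Rabs_right; lra.
  - exists N. specialize (HN N (le_n _)). rewrite <- pow_inv.
    exact (Rle_lt_trans _ _ _ (Rle_abs _) HN).
Qed.

Lemma rational_dense (x : R) (n : nat) :
  exists m, (Rabs (rational m - x) <= / 2 ^ n)%R.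
Proof.
  set (z := up (x * 2 ^ n)).
  exists (to_nat (to_nat (Z.to_nat z, Z.to_nat (- z)), 2 ^ n - 1)).
  unfold rational. rewrite !cancel_of_to.
  assert (Hz : (INR (Z.to_nat z) - INR (Z.to_nat (- z)) = IZR z)%R).
  { rewrite !INR_IZR_INZ, <- minus_IZR. f_equal. lia. }
  assert (H0 : 2 ^ n <> 0) by (apply Nat.pow_nonzero; lia).
  replace (S (2 ^ n - 1)) with (2 ^ n) by lia.
  rewrite Hz, pow_INR. replace (INR 2) with 2%R by reflexivity.
  assert (Hp : (0 < 2 ^ n)%R) by (apply pow_lt; lra).
  replace (IZR z / 2 ^ n - x)%R with ((IZR z - x * 2 ^ n) * / 2 ^ n)%R by (field; lra).
  pose proof (Rinv_0_lt_compat _ Hp).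
  destruct (archimed (x * 2 ^ n)) as [H1 H2]. fold z in H1, H2.
  rewrite Rabs_right.
  - rewrite <- (Rmult_1_l (/ 2 ^ n)) at 2. apply Rmult_le_compat_r; lra.
  - apply Rle_ge, Rmult_le_pos; lra.
Qed.

(** Fast rational Cauchy names. *)
Definition real_space : repspace.
Proof.
  refine {| pt := R;
            names := fun p x => forall n, (Rabs (rational (p n) - x) <= / 2 ^ n)%R |}.
  - intros p x y H1 H2. apply NNPP. intro H.
    assert (He : (0 < Rabs (x - y) / 2)%R).
    { assert (0 < Rabs (x - y))%R by (apply Rabs_pos_lt; lra). lra. }
    destruct (pow2_inv_small He) as [n Hn]. specialize (H1 n). specialize (H2 n).
    revert Hn H1 H2. unfold Rabs.
    repeat destruct Rcase_abs; lra.
  - intro x. exists (fun n => proj1_sig (constructive_indefinite_description _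
                                 (rational_dense x n))).
    intro n. apply proj2_sig.
Defined.

Definition unit_interval : repspace :=
  subspace (X := real_space) (fun x : R => (0 <= x <= 1)%R).

Definition hilbert_cube : repspace := omega_power unit_interval.

(** * Function spaces

    Surjectivity of the representation: every continuous partial map on Baire
    space extends to a coded one.  The code searches the oracle, at arguments
    [(n, (k, prefix of length k))], for the value of the [n]-th output. *)

Definition prefix (q : baire) : nat -> nat :=
  fix go k := match k with 0 => 0 | S i => to_nat (go i, q i) end.

Lemma prefix_agree q q' k : prefix q k = prefix q' k -> agree k q q'.
Proof.
  induction k as [|k IH]; cbn [prefix]; intros H i Hi; [lia|].
  apply to_nat_inj in H. destruct H as [H1 H2].
  destruct (Nat.eq_dec i k) as [->|Hne]; trivial. apply IH; [assumption | lia].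
Qed.

Definition c_id := Pair Fst Snd.
Definition c_double := Comp (Prec Zero (Comp Succ (Comp Succ (Comp Snd Snd)))) (Pair Zero c_id).
Definition c_left := Comp Oracle c_double.
Definition c_right := Comp Oracle (Comp Succ c_double).
Definition c_prefix := Prec Zero (Pair (Comp Snd Snd) (Comp c_right (Comp Fst Snd))).
Definition c_look := Comp c_left (Pair Fst (Pair Snd c_prefix)).
Definition c_test := Comp (Prec (Comp Succ Zero) Zero) (Pair Zero c_look).
Definition c_search :=
  Comp (Prec Zero (Comp Fst Snd)) (Pair Zero (Comp c_look (Pair c_id (Mu c_test)))).

Lemma ev_id o x : ev o c_id x x.
Proof.
  exists (fst (of_nat x)), (snd (of_nat x)). repeat split.
  now rewrite <- surjective_pairing, cancel_to_of.
Qed.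

Lemma ev_double o n : ev o c_double n (2 * n).
Proof.
  exists (to_nat (0, n)). split.
  - exists 0, n. repeat split. apply ev_id.
  - cbn [ev]. rewrite cancel_of_to. cbn [fst snd].
    induction n as [|n IH]; [reflexivity|].
    exists (2 * n). split; [exact IH|].
    exists (S (2 * n)). split; [|cbn [ev]; lia].
    exists (2 * n). split; [|reflexivity].
    exists (to_nat (n, 2 * n)). cbn [ev]. now rewrite !cancel_of_to.
Qed.

Lemma ev_left t q n : ev (join t q) c_left n (t n).
Proof.
  exists (2 * n). split; [apply ev_double|]. cbn [ev].
  change (t n = evens (join t q) n). now rewrite evens_join.
Qed.

Lemma ev_right t q n : ev (join t q) c_right n (q n).
Proof.
  exists (2 * n + 1). split.
  - exists (2 * n). split; [apply ev_double | cbn [ev]; lia].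
  - cbn [ev]. change (q n = odds (join t q) n). now rewrite odds_join.
Qed.

Lemma ev_prefix t q n k : ev (join t q) c_prefix (to_nat (n, k)) (prefix q k).
Proof.
  unfold c_prefix. cbn -[c_right to_nat of_nat]. rewrite cancel_of_to. cbn [fst snd].
  induction k as [|k IH]; [reflexivity|].
  exists (prefix q k). split; [exact IH|].
  exists (prefix q k), (q k). split; [|split].
  - exists (to_nat (k, prefix q k)). now rewrite !cancel_of_to.
  - exists k. split; [|apply ev_right].
    exists (to_nat (k, prefix q k)). now rewrite !cancel_of_to.
  - reflexivity.
Qed.

Lemma ev_look t q n k :
  ev (join t q) c_look (to_nat (n, k)) (t (to_nat (n, to_nat (k, prefix q k)))).
Proof.
  exists (to_nat (n, to_nat (k, prefix q k))). split; [|apply ev_left].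
  exists n, (to_nat (k, prefix q k)). split; [|split; trivial].
  - cbn [ev]. now rewrite cancel_of_to.
  - exists k, (prefix q k). split; [|split; trivial].
    + cbn [ev]. now rewrite cancel_of_to.
    + apply ev_prefix.
Qed.

Lemma ev_test t q n k :
  ev (join t q) c_test (to_nat (n, k))
     (match t (to_nat (n, to_nat (k, prefix q k))) with 0 => 1 | S _ => 0 end).
Proof.
  pose proof (ev_look t q n k) as H. revert H.
  generalize (t (to_nat (n, to_nat (k, prefix q k)))) as v. intros v H.
  exists (to_nat (0, v)). split.
  - exists 0, v. repeat split. exact H.
  - cbn [ev]. rewrite cancel_of_to. cbn [fst snd].
    induction v as [|v IH].
    + now exists 0.
    + clear H IH. assert (Hv : forall w, exists r,
        (fix rec (n : nat) : nat -> Prop :=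
           match n with
           | 0 => fun y => exists z, z = 0 /\ y = S z
           | S k => fun y => exists r, rec k r /\ y = 0
           end) w r).
      { intros [|w]; [now exists 1, 0|]. exists 0.
        induction w as [|w IH]; [|now exists 0].
        exists 1. split; trivial. now exists 0. }
      destruct (Hv v) as [r Hr]. exists r. split; [exact Hr | reflexivity].
Qed.

Lemma ev_search t q n k v :
  t (to_nat (n, to_nat (k, prefix q k))) = S v ->
  (forall j, j < k -> t (to_nat (n, to_nat (j, prefix q j))) = 0) ->
  ev (join t q) c_search n v.
Proof.
  intros Hk Hj. exists (to_nat (0, S v)). split.
  - exists 0, (S v). repeat split. exists (to_nat (n, k)). split.
    + exists n, k. split; [apply ev_id | split; trivial]. split.
      * pose proof (ev_test t q n k) as H. now rewrite Hk in H.
      * intros j Hlt. exists 0. pose proof (ev_test t q n j) as H.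
        now rewrite (Hj j Hlt) in H.
    + rewrite <- Hk. apply ev_look.
  - cbn [ev]. rewrite cancel_of_to. cbn [fst snd].
    assert (Hv : forall w, (fix rec (n : nat) : nat -> Prop :=
           match n with
           | 0 => fun y => y = 0
           | S k => fun y => exists r, rec k r /\ exists z,
               z = snd (of_nat (to_nat (0, to_nat (k, r)))) /\ y = fst (of_nat z)
           end) w (pred w)).
    { induction w as [|w IH]; [reflexivity|]. exists (pred w).
      split; [exact IH|]. exists (to_nat (w, pred w)). now rewrite !cancel_of_to. }
    exact (Hv (S v)).
Qed.

Lemma baire_choice (P : nat -> nat -> Prop) :
  (forall m, exists w, P m w) -> exists t : baire, forall m, P m (t m).
Proof.
  intro H. exists (fun m => proj1_sig (constructive_indefinite_description _ (H m))).
  intro m. apply proj2_sig.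
Qed.

Lemma continuous_coded (G : pmap) :
  pmap_continuous G -> exists p, forall q r, G q r -> coded p q r.
Proof.
  intro HG.
  pose (spec := fun n k h v =>
    (exists q r, G q r /\ prefix q k = h) /\
    forall q r, G q r -> prefix q k = h -> r n = v).
  assert (Ht : exists t : baire, forall n k h,
    (forall v, t (to_nat (n, to_nat (k, h))) = S v -> spec n k h v) /\
    (t (to_nat (n, to_nat (k, h))) = 0 -> forall v, ~ spec n k h v)).
  { assert (Hm : forall m, exists w,
      let n := fst (of_nat m) in
      let k := fst (of_nat (snd (of_nat m))) in
      let h := snd (of_nat (snd (of_nat m))) in
      (forall v, w = S v -> spec n k h v) /\ (w = 0 -> forall v, ~ spec n k h v)).
    { intro m. cbv zeta.
      match goal with |- context [spec ?n ?k ?h] =>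
        destruct (classic (exists v, spec n k h v)) as [[v Hv]|Hn] end.
      - exists (S v). split; [|discriminate]. intros u Hu. injection Hu as <-. exact Hv.
      - exists 0. split; [discriminate|]. intros _ v Hv. apply Hn. now exists v. }
    destruct (baire_choice Hm) as [t Ht]. exists t. intros n k h.
    specialize (Ht (to_nat (n, to_nat (k, h)))). cbv zeta in Ht.
    rewrite !cancel_of_to in Ht. cbn [fst snd] in Ht. rewrite !cancel_of_to in Ht.
    exact Ht. }
  destruct Ht as [t Ht].
  exists (fun m => match m with 0 => encode c_search | S i => t i end).
  intros q r Hqr. exists c_search. split; [reflexivity|]. intro n.
  change (ev (join t q) c_search n (r n)).
  assert (Hex : exists k, t (to_nat (n, to_nat (k, prefix q k))) <> 0).
  { destruct (HG q r Hqr (S n)) as [k Hk]. exists k. intro H0.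
    refine (proj2 (Ht n k (prefix q k)) H0 (r n) _). split.
    - now exists q, r.
    - intros q' r' Hq' Hp. symmetry. apply (Hk q' r' Hq'); [|lia].
      now apply prefix_agree. }
  destruct (dec_inh_nat_subset_has_unique_least_element
              (fun k => t (to_nat (n, to_nat (k, prefix q k))) <> 0)) as [k [[Hk Hl] _]];
    [|exact Hex|].
  { intro k. apply classic. }
  destruct (t (to_nat (n, to_nat (k, prefix q k)))) as [|v] eqn:E; [congruence|].
  assert (Hv : r n = v).
  { apply (proj2 (proj1 (Ht n k (prefix q k)) v E) q r Hqr eq_refl). }
  rewrite Hv. apply (ev_search E). intros j Hj.
  destruct (t (to_nat (n, to_nat (j, prefix q j)))) as [|w] eqn:E'; trivial.
  enough (k <= j) by lia. apply Hl. now rewrite E'.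
Qed.

Definition function_space (X Y : repspace) : repspace.
Proof.
  refine {| pt := {f : X -> Y | continuously_realisable (single f)};
            names := fun p f => realiser (coded p) (single (proj1_sig f)) |}.
  - intros p [f Hf] [g Hg] H1 H2. cbn in H1, H2.
    assert (E : f = g).
    { apply functional_extensionality. intro x. destruct (names_surj x) as [q Hq].
      destruct (H1 x q) as (r & y & Hr & Hy & Hn); [now exists (f x) | trivial|].
      destruct (H2 x q) as (r' & y' & Hr' & Hy' & Hn'); [now exists (g x) | trivial|].
      unfold single in *. subst y y'.
      rewrite (pgraph_fun Hr Hr') in Hn. exact (names_fun Hn Hn'). }
    subst g. f_equal. apply proof_irrelevance.
  - intros [f (G & HG & Hr)]. destruct (continuous_coded HG) as [p Hp].
    exists p. intros x q Hx Hq. destruct (Hr x q Hx Hq) as (r & y & H1 & H2 & H3).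
    exists r, y. split; [exact (Hp q r H1) | now split].
Defined.

(** * Open and closed sets *)

Definition opens (X : repspace) : repspace := function_space X sierp.

Definition in_open (X : repspace) (U : opens X) (x : X) : Prop := proj1_sig U x = top.

Definition closeds (X : repspace) : repspace.
Proof.
  refine {| pt := {C : X -> Prop | exists U : opens X, forall x, C x <-> ~ in_open U x};
            names := fun p C => exists U : opens X,
              names p U /\ forall x, proj1_sig C x <-> ~ in_open U x |}.
  - intros p [C HC] [D HD] (U & HU & H1) (V & HV & H2). cbn in H1, H2.
    rewrite <- (names_fun HU HV) in H2.
    assert (E : C = D).
    { apply functional_extensionality. intro x. apply propositional_extensionality.
      now rewrite H1, H2. }
    subst D. f_equal. apply proof_irrelevance.
  - intros [C [U HU]]. destruct (names_surj U) as [p Hp]. now exists p, U.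
Defined.

Definition in_closed (X : repspace) (C : closeds X) (x : X) : Prop := proj1_sig C x.

(** * Embeddings and normality *)

Definition inverse_on_image (X Y : repspace) (i : X -> Y) :
  mvmap (subspace (X := Y) (fun y => exists x, i x = y)) X :=
  fun y x => i x = proj1_sig y.

Definition computably_embeds (X Y : repspace) : Prop :=
  exists i : X -> Y,
    (forall x x', i x = i x' -> x = x') /\
    computable (single i) /\
    computable (@inverse_on_image X Y i).

Definition Norm (X : repspace) :
  mvmap (prod_space (closeds X) (closeds X)) (prod_space (opens X) (opens X)) :=
  fun AB UV =>
    (forall x, ~ (in_open (fst UV) x /\ in_open (snd UV) x)) /\
    (forall x, in_closed (fst AB) x -> in_open (fst UV) x) /\
    (forall x, in_closed (snd AB) x -> in_open (snd UV) x).

(** The domain of [Norm] is prescribed to be all disjoint pairs; for the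
    relation above this says that disjoint closed sets can be separated. *)
Definition computably_normal (X : repspace) : Prop :=
  (forall AB, dom (@Norm X) AB <->
     forall x, ~ (in_closed (fst AB) x /\ in_closed (snd AB) x)) /\
  computable (@Norm X).

(** * The spaces [S_A] and the difference hierarchy *)

Definition S_ (A : nat -> Prop) : repspace :=
  subspace (X := prod_space nat_space sierp)
    (fun z : nat * sierpinski =>
       (exists n, A n /\ z = (n, top)) \/ (exists n, ~ A n /\ z = (n, bot))).

Definition two_ce (A : nat -> Prop) : Prop :=
  exists B C : nat -> Prop, ce B /\ ce C /\ forall n, A n <-> B n /\ ~ C n.

(* Main.v *)
(** (3) => (1): let [n] be enumerated into [B] at stage [s].  From then on a
    name of the point over [n] tells whether [n] is in [A], by showing [top] or
    by waiting for [n] to enter [C].  So the real [2^-s] if [n] is in [A], [0]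
    otherwise, is computable from that name, and it determines whether [n] is
    in [A] in the sense of [sierp].

    (1) => (3): map the name [(n, 1, 1, ...)] into the cube and back.  [B] is
    the event that the result shows [top]; it uses a finite part of a point of
    the cube.  [C] is the event that the image of [(n, 0, 0, ...)] is seen to
    leave that part.

    (3) => (2): let two open sets cover the space.  Run both on
    [(n, 0, 0, ...)] until one accepts or [n] enters [B].  What is accepted
    here belongs to the open set even if [n] is in [A], because acceptance
    uses a finite prefix.  If [n] enters [B] first, decide whether [n] is in
    [A] and run both sets on a canonical name of the point over [n].

    (2) => (3): apply the normality operator to the complements of
    [O1 = {m <> n} + {top}] and of [O2 = {m <> n}] or the whole space, where
    [n] is added to [O2] at stage [k] or never.  [B] is the event that the
    second separating set accepts [(n, 1, 1, ...)] while [n] has not been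
    added; [C] that for some later [k] the first one accepts [(n, 0, 0, ...)]. *)

From Stdlib Require Import Reals Lra Lia Arith Cantor List.
From Stdlib Require Import Classical ClassicalEpsilon FunctionalExtensionality.
Require Import Defs.

(** * Pairing and basic rules for the evaluation relation *)

Definition pr (a b : nat) : nat := to_nat (a, b).
Definition p1 (z : nat) : nat := fst (of_nat z).
Definition p2 (z : nat) : nat := snd (of_nat z).

Lemma p1_pr a b : p1 (pr a b) = a.
Proof. unfold p1, pr. now rewrite cancel_of_to. Qed.

Lemma p2_pr a b : p2 (pr a b) = b.
Proof. unfold p2, pr. now rewrite cancel_of_to. Qed.

Lemma pr_eta z : pr (p1 z) (p2 z) = z.
Proof. unfold p1, p2, pr. rewrite <- surjective_pairing. apply cancel_to_of. Qed.

Hint Rewrite p1_pr p2_pr : pair.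

Lemma ev_pair o a b x u v :
  ev o a x u -> ev o b x v -> ev o (Pair a b) x (pr u v).
Proof. intros H1 H2. now exists u, v. Qed.

Lemma ev_comp o a b x z y : ev o b x z -> ev o a z y -> ev o (Comp a b) x y.
Proof. intros H1 H2. now exists z. Qed.

Lemma ev_prec_0 o a b u y : ev o (Prec a b) (pr u 0) y <-> ev o a u y.
Proof. unfold pr. cbn [ev]. cbv zeta. now rewrite cancel_of_to. Qed.

Lemma ev_prec_S o a b u k y :
  ev o (Prec a b) (pr u (S k)) y <->
  exists r, ev o (Prec a b) (pr u k) r /\ ev o b (pr u (pr k r)) y.
Proof. unfold pr. cbn [ev]. cbv zeta. now rewrite !cancel_of_to. Qed.

(** * Total computable functionals *)

Definition Cf (f : baire -> nat -> nat) : Prop :=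
  exists c, forall o x, ev o c x (f o x).

Definition Cfb (b : baire -> nat -> bool) : Prop :=
  Cf (fun o x => if b o x then 1 else 0).

Lemma Cf_ext f g : Cf f -> (forall o x, f o x = g o x) -> Cf g.
Proof. intros [c H] E. exists c. intros o x. rewrite <- E. apply H. Qed.

Lemma Cf_comp f g : Cf f -> Cf g -> Cf (fun o x => f o (g o x)).
Proof.
  intros [c Hc] [d Hd]. exists (Comp c d). intros o x.
  exact (ev_comp _ _ _ _ _ _ (Hd o x) (Hc o _)).
Qed.

Lemma Cf_id : Cf (fun _ x => x).
Proof. exists c_id. intros. apply ev_id. Qed.

Lemma Cf_S f : Cf f -> Cf (fun o x => S (f o x)).
Proof. apply (Cf_comp (fun _ x => S x)). now exists Succ. Qed.

Lemma Cf_const k : Cf (fun _ _ => k).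
Proof. induction k as [|k IH]; [now exists Zero | exact (Cf_S _ IH)]. Qed.

Lemma Cf_p1 f : Cf f -> Cf (fun o x => p1 (f o x)).
Proof. apply (Cf_comp (fun _ x => p1 x)). now exists Fst. Qed.

Lemma Cf_p2 f : Cf f -> Cf (fun o x => p2 (f o x)).
Proof. apply (Cf_comp (fun _ x => p2 x)). now exists Snd. Qed.

Lemma Cf_oracle f : Cf f -> Cf (fun o x => o (f o x)).
Proof. apply (Cf_comp (fun o x => o x)). now exists Oracle. Qed.

Lemma Cf_pr f g : Cf f -> Cf g -> Cf (fun o x => pr (f o x) (g o x)).
Proof.
  intros [c Hc] [d Hd]. exists (Pair c d). intros o x. now apply ev_pair.
Qed.

Lemma Cf_app2 (h : baire -> nat -> nat -> nat) f g :
  Cf (fun o z => h o (p1 z) (p2 z)) -> Cf f -> Cf g ->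
  Cf (fun o x => h o (f o x) (g o x)).
Proof.
  intros Hh Hf Hg. apply (Cf_ext _ _ (Cf_comp _ _ Hh (Cf_pr _ _ Hf Hg))).
  intros o x. now rewrite p1_pr, p2_pr.
Qed.

Lemma Cf_rec a n (b : baire -> nat -> nat -> nat -> nat) :
  Cf a -> Cf (fun o z => b o (p1 z) (p1 (p2 z)) (p2 (p2 z))) -> Cf n ->
  Cf (fun o x => nat_rect (fun _ => nat) (a o x) (b o x) (n o x)).
Proof.
  intros [c Hc] [d Hd] Hn.
  apply (Cf_app2 (fun o x k => nat_rect (fun _ => nat) (a o x) (b o x) k));
    [|apply Cf_id | exact Hn].
  exists (Prec c d). intros o x. rewrite <- (pr_eta x) at 1.
  generalize (p1 x) as u, (p2 x) as k. intros u k.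
  induction k as [|k IH]; [now apply ev_prec_0|]. apply ev_prec_S. eexists.
  split; [exact IH|]. cbn [nat_rect].
  match goal with |- ev _ _ ?z _ => pose proof (Hd o z) as H end.
  now rewrite !p2_pr, !p1_pr in H.
Qed.

Lemma Cf_iter n (f : baire -> nat -> nat -> nat) a :
  Cf (fun o z => f o (p1 z) (p2 z)) -> Cf a -> Cf n ->
  Cf (fun o x => Nat.iter (n o x) (f o x) (a o x)).
Proof.
  intros Hf Ha Hn.
  apply (Cf_rec a n (fun o x _ r => f o x r)); [exact Ha | | exact Hn].
  apply (Cf_app2 f); [exact Hf | |].
  - apply Cf_p1, Cf_id.
  - apply Cf_p2, Cf_p2, Cf_id.
Qed.

Lemma Cf_pred f : Cf f -> Cf (fun o x => Nat.pred (f o x)).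
Proof.
  apply (Cf_comp (fun _ x => Nat.pred x)).
  apply (Cf_ext (fun o x => nat_rect (fun _ => nat) 0 (fun k _ => k) x)).
  - apply (Cf_rec (fun _ _ => 0) (fun _ x => x) (fun _ _ k _ => k)).
    + apply Cf_const.
    + apply Cf_p1, Cf_p2, Cf_id.
    + apply Cf_id.
  - now intros _ [|x].
Qed.

Lemma Cf_add f g : Cf f -> Cf g -> Cf (fun o x => f o x + g o x).
Proof.
  intros Hf Hg.
  apply (Cf_ext (fun o x => Nat.iter (g o x) S (f o x))).
  - apply (Cf_iter g (fun _ _ => S)); [|assumption..]. apply Cf_S, Cf_p2, Cf_id.
  - intros o x. induction (g o x) as [|k IH]; [cbn; lia | rewrite Nat.iter_succ, IH; cbn; lia].
Qed.

Lemma Cf_sub f g : Cf f -> Cf g -> Cf (fun o x => f o x - g o x).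
Proof.
  intros Hf Hg.
  apply (Cf_ext (fun o x => Nat.iter (g o x) Nat.pred (f o x))).
  - apply (Cf_iter g (fun _ _ => Nat.pred)); [|assumption..].
    apply Cf_pred, Cf_p2, Cf_id.
  - intros o x. induction (g o x) as [|k IH]; [cbn; lia | rewrite Nat.iter_succ, IH; cbn; lia].
Qed.

Lemma Cf_mul f g : Cf f -> Cf g -> Cf (fun o x => f o x * g o x).
Proof.
  intros Hf Hg.
  apply (Cf_app2 (fun _ u v => u * v)); [|assumption..].
  apply (Cf_ext (fun o x => Nat.iter (p2 x) (Nat.add (p1 x)) 0)).
  - apply (Cf_iter (fun _ x => p2 x) (fun _ x => Nat.add (p1 x))).
    + apply Cf_add; [apply Cf_p1, Cf_p1 | apply Cf_p2]; apply Cf_id.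
    + apply Cf_const.
    + apply Cf_p2, Cf_id.
  - intros o x. induction (p2 x) as [|k IH]; [cbn; lia | rewrite Nat.iter_succ, IH; cbn; lia].
Qed.

Lemma Cf_pow2 f : Cf f -> Cf (fun o x => 2 ^ f o x).
Proof.
  intros Hf. apply (Cf_ext (fun o x => Nat.iter (f o x) (Nat.mul 2) 1)).
  - apply (Cf_iter f (fun _ _ => Nat.mul 2)); [|apply Cf_const | exact Hf].
    apply Cf_mul; [apply Cf_const | apply Cf_p2, Cf_id].
  - intros o x. induction (f o x) as [|k IH]; [cbn; lia | rewrite Nat.iter_succ, IH; cbn; lia].
Qed.

(** Both branches are total, so the conditional is a sum of products with the 0-1 value of [b] and
    its complement. *)
Lemma Cf_if b f g :
  Cfb b -> Cf f -> Cf g -> Cf (fun o x => if b o x then f o x else g o x).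
Proof.
  intros Hb Hf Hg.
  apply (Cf_ext (fun o x =>
    f o x * (if b o x then 1 else 0) + g o x * (1 - (if b o x then 1 else 0)))).
  - apply Cf_add; apply Cf_mul; trivial. apply Cf_sub; [apply Cf_const | exact Hb].
  - intros o x. destruct (b o x); lia.
Qed.

Lemma Cfb_leb f g : Cf f -> Cf g -> Cfb (fun o x => f o x <=? g o x).
Proof.
  intros Hf Hg. apply (Cf_ext (fun o x => 1 - (f o x - g o x))).
  - apply Cf_sub; [apply Cf_const | now apply Cf_sub].
  - intros o x. destruct (Nat.leb_spec (f o x) (g o x)); lia.
Qed.

Lemma Cfb_negb b : Cfb b -> Cfb (fun o x => negb (b o x)).
Proof.
  intros Hb. apply (Cf_ext (fun o x => if b o x then 0 else 1)).
  - apply Cf_if; trivial; apply Cf_const.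
  - intros o x. now destruct (b o x).
Qed.

Lemma Cfb_andb a b : Cfb a -> Cfb b -> Cfb (fun o x => a o x && b o x)%bool.
Proof.
  intros Ha Hb. apply (Cf_ext (fun o x => if a o x then if b o x then 1 else 0 else 0)).
  - apply Cf_if; [exact Ha | apply Cf_if | ]; trivial; apply Cf_const.
  - intros o x. now destruct (a o x).
Qed.

Lemma Cfb_orb a b : Cfb a -> Cfb b -> Cfb (fun o x => a o x || b o x)%bool.
Proof.
  intros Ha Hb. apply (Cf_ext (fun o x => if a o x then 1 else if b o x then 1 else 0)).
  - apply Cf_if; [exact Ha | | apply Cf_if]; trivial; apply Cf_const.
  - intros o x. now destruct (a o x).
Qed.

Lemma Cfb_if b f g :
  Cfb b -> Cfb f -> Cfb g -> Cfb (fun o x => if b o x then f o x else g o x).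
Proof.
  intros Hb Hf Hg. refine (Cf_ext _ _ (Cf_if _ _ _ Hb Hf Hg) _).
  intros o x. now destruct (b o x).
Qed.

Lemma Cfb_ltb f g : Cf f -> Cf g -> Cfb (fun o x => f o x <? g o x).
Proof. intros Hf Hg. apply Cfb_leb; trivial. now apply Cf_S. Qed.

Lemma Cfb_eqb f g : Cf f -> Cf g -> Cfb (fun o x => f o x =? g o x).
Proof.
  intros Hf Hg.
  apply (Cf_ext (fun o x => if (f o x <=? g o x) && (g o x <=? f o x) then 1 else 0)%bool).
  - apply Cfb_andb; now apply Cfb_leb.
  - intros o x. destruct (Nat.leb_spec (f o x) (g o x)), (Nat.leb_spec (g o x) (f o x)),
      (Nat.eqb_spec (f o x) (g o x)); cbn; lia.
Qed.

Lemma Cfb_even f : Cf f -> Cfb (fun o x => Nat.even (f o x)).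
Proof.
  intros Hf. apply (Cf_ext (fun o x => Nat.iter (f o x) (fun r => 1 - r) 1)).
  - apply (Cf_iter f (fun _ _ r => 1 - r)); [|apply Cf_const | exact Hf].
    apply Cf_sub; [apply Cf_const | apply Cf_p2, Cf_id].
  - intros o x. induction (f o x) as [|k IH]; [reflexivity|].
    rewrite Nat.even_succ, <- Nat.negb_even. rewrite Nat.iter_succ.
    rewrite IH. now destruct (Nat.even k).
Qed.

Lemma Cf_div2 f : Cf f -> Cf (fun o x => Nat.div2 (f o x)).
Proof.
  apply (Cf_comp (fun _ x => Nat.div2 x)).
  apply (Cf_ext (fun _ x => nat_rect (fun _ => nat) 0
           (fun k r => if Nat.even k then r else S r) x)).
  - apply (Cf_rec (fun _ _ => 0) (fun _ x => x)
             (fun _ _ k r => if Nat.even k then r else S r)).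
    + apply Cf_const.
    + apply Cf_if.
      * apply Cfb_even, Cf_p1, Cf_p2, Cf_id.
      * apply Cf_p2, Cf_p2, Cf_id.
      * apply Cf_S, Cf_p2, Cf_p2, Cf_id.
    + apply Cf_id.
  - intros _ x. induction x as [|x IH]; [reflexivity|]. cbn [nat_rect]. rewrite IH.
    destruct (Nat.Even_or_Odd x) as [[k ->]|[k ->]].
    + rewrite Nat.even_even. now rewrite Nat.div2_succ_double, Nat.div2_double.
    + rewrite Nat.even_odd.
      rewrite Nat.add_1_r, Nat.div2_succ_double.
      now replace (S (S (2 * k))) with (2 * S k) by lia; rewrite Nat.div2_double.
Qed.

(** Syntax-directed: hypotheses are tried first, and a goal [Cf _] with no listed head is tried as a
    conditional. *)
Ltac cf_step :=
  cbv beta;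
  lazymatch goal with
  | H : Cf ?f |- Cf ?f => exact H
  | H : Cfb ?f |- Cfb ?f => exact H
  | |- Cfb (fun o x => Nat.eqb (@?f o x) (@?g o x)) => apply Cfb_eqb
  | |- Cfb (fun o x => Nat.ltb (@?f o x) (@?g o x)) => apply Cfb_ltb
  | |- Cfb (fun o x => Nat.leb (@?f o x) (@?g o x)) => apply Cfb_leb
  | |- Cfb (fun o x => Nat.even (@?f o x)) => apply Cfb_even
  | |- Cfb (fun o x => andb (@?f o x) (@?g o x)) => apply Cfb_andb
  | |- Cfb (fun o x => orb (@?f o x) (@?g o x)) => apply Cfb_orb
  | |- Cfb (fun o x => negb (@?f o x)) => apply Cfb_negb
  | |- Cf (fun o x => x) => apply Cf_id
  | |- Cf (fun _ _ => ?k) => apply (Cf_const k)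
  | |- Cf (fun o x => S (@?f o x)) => apply Cf_S
  | |- Cf (fun o x => p1 (@?f o x)) => apply Cf_p1
  | |- Cf (fun o x => p2 (@?f o x)) => apply Cf_p2
  | |- Cf (fun o x => pr (@?f o x) (@?g o x)) => apply Cf_pr
  | |- Cf (fun o x => Nat.pred (@?f o x)) => apply Cf_pred
  | |- Cf (fun o x => Nat.add (@?f o x) (@?g o x)) => apply Cf_add
  | |- Cf (fun o x => Nat.sub (@?f o x) (@?g o x)) => apply Cf_sub
  | |- Cf (fun o x => Nat.mul (@?f o x) (@?g o x)) => apply Cf_mul
  | |- Cf (fun o x => Nat.pow 2 (@?f o x)) => apply Cf_pow2
  | |- Cf (fun o x => Nat.div2 (@?f o x)) => apply Cf_div2
  | |- Cf (fun o x => o (@?f o x)) => apply Cf_oracle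
  | |- Cf _ => apply Cf_if
  end.

Ltac cf := repeat cf_step.

(** * Oracle substitution *)

Definition c_assoc := Pair (Comp Fst Fst) (Pair (Comp Snd Fst) Snd).

(** Runs [c] on [x] when started on [pr n x], answering an oracle question [m]
    by the value of [d] on [pr n m]. *)
Fixpoint rel (d c : code) : code :=
  match c with
  | Zero => Zero
  | Succ => Comp Succ Snd
  | Fst => Comp Fst Snd
  | Snd => Comp Snd Snd
  | Oracle => d
  | Pair a b => Pair (rel d a) (rel d b)
  | Comp a b => Comp (rel d a) (Pair Fst (rel d b))
  | Prec a b => Comp (Prec (rel d a) (Comp (rel d b) c_assoc))
                  (Pair (Pair Fst (Comp Fst Snd)) (Comp Snd Snd))
  | Mu a => Mu (Comp (rel d a) c_assoc)
  end.

Lemma ev_Fst o a b : ev o Fst (pr a b) a.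
Proof. cbn [ev]. symmetry. apply p1_pr. Qed.

Lemma ev_Snd o a b : ev o Snd (pr a b) b.
Proof. cbn [ev]. symmetry. apply p2_pr. Qed.

(** [Prec] and [Mu] append their counter to the right of the whole input, whereas [rel] expects the
    parameter [n] outermost; this regrouping restores that shape. *)
Lemma ev_assoc o n u w : ev o c_assoc (pr (pr n u) w) (pr n (pr u w)).
Proof.
  repeat (apply ev_pair || (eapply ev_comp; [apply ev_Fst|]) || apply ev_Fst || apply ev_Snd).
Qed.

Lemma ev_rel_prec_arg o n u k :
  ev o (Pair (Pair Fst (Comp Fst Snd)) (Comp Snd Snd)) (pr n (pr u k)) (pr (pr n u) k).
Proof.
  repeat (apply ev_pair || (eapply ev_comp; [apply ev_Snd|]) || apply ev_Fst || apply ev_Snd).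
Qed.

Lemma ev_rel o d w n :
  (forall m, ev o d (pr n m) (w m)) ->
  forall c x y, ev w c x y -> ev o (rel d c) (pr n x) y.
Proof.
  intros Hd c.
  induction c as [ | | | | |a IHa b IHb|a IHa b IHb|a IHa b IHb|a IHa]; intros x y H.
  - exact H.
  - eapply ev_comp; [apply ev_Snd | exact H].
  - eapply ev_comp; [apply ev_Snd | exact H].
  - eapply ev_comp; [apply ev_Snd | exact H].
  - rewrite H. apply Hd.
  - destruct H as (u & v & Hu & Hv & ->). apply ev_pair; auto.
  - destruct H as (z & Hz & Hy). eapply ev_comp; [|now apply IHa; eauto].
    apply ev_pair; [apply ev_Fst | auto].
  - rewrite <- (pr_eta x) in *. revert H. generalize (p1 x) as u, (p2 x) as k. intros u k H.
    eapply ev_comp; [apply ev_rel_prec_arg|]. revert y H.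
    induction k as [|k IH]; intros y H.
    + apply ev_prec_0 in H. apply ev_prec_0. auto.
    + apply ev_prec_S in H. destruct H as (r & Hr & Hy). apply ev_prec_S.
      exists r. split; [auto|]. eapply ev_comp; [apply ev_assoc | auto].
  - destruct H as [H0 H1]. split.
    + eapply ev_comp; [apply ev_assoc | exact (IHa _ _ H0)].
    + intros k Hk. destruct (H1 k Hk) as [v Hv]. exists v.
      eapply ev_comp; [apply ev_assoc | exact (IHa _ _ Hv)].
Qed.

Lemma ev_comp_inv o a b x z y : ev o b x z -> ev o (Comp a b) x y -> ev o a z y.
Proof. intros Hz (z' & Hz' & H). now rewrite (ev_fun Hz Hz'). Qed.

(** The finite use principle for the oracle computed by [d], which may be partial. *)
Lemma ev_rel_use o d n :
  forall c x y, ev o (rel d c) (pr n x) y ->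
  exists L, (forall m, In m L -> exists v, ev o d (pr n m) v) /\
    forall w, (forall m, In m L -> ev o d (pr n m) (w m)) -> ev w c x y.
Proof.
  intro c.
  induction c as [ | | | | |a IHa b IHb|a IHa b IHb|a IHa b IHb|a IHa]; intros x y H.
  - exists nil. split; [easy|]. intros w _. exact H.
  - exists nil. split; [easy|]. intros w _. exact (ev_comp_inv _ _ _ _ _ _ (ev_Snd _ _ _) H).
  - exists nil. split; [easy|]. intros w _. exact (ev_comp_inv _ _ _ _ _ _ (ev_Snd _ _ _) H).
  - exists nil. split; [easy|]. intros w _. exact (ev_comp_inv _ _ _ _ _ _ (ev_Snd _ _ _) H).
  - exists (x :: nil). split.
    + intros m [<-|[]]. now exists y.
    + intros w Hw. exact (ev_fun H (Hw x (or_introl eq_refl))).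
  - destruct H as (u & v & Hu & Hv & ->).
    destruct (IHa _ _ Hu) as (L & HL & HLa), (IHb _ _ Hv) as (M & HM & HMb).
    exists (L ++ M). split.
    + intros m Hm. apply in_app_or in Hm. destruct Hm; auto.
    + intros w Hw. apply ev_pair; [apply HLa | apply HMb]; intros m Hm; apply Hw, in_or_app; auto.
  - destruct H as (z & (u & v & Hu & Hv & ->) & Hy).
    rewrite (ev_fun Hu (ev_Fst o n x)) in Hy.
    destruct (IHa _ _ Hy) as (L & HL & HLa), (IHb _ _ Hv) as (M & HM & HMb).
    exists (L ++ M). split.
    + intros m Hm. apply in_app_or in Hm. destruct Hm; auto.
    + intros w Hw. apply ev_comp with v; [apply HMb | apply HLa];
        intros m Hm; apply Hw, in_or_app; auto.
  - rewrite <- (pr_eta x) in *. revert H. generalize (p1 x) as u, (p2 x) as k. intros u k H.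
    apply (ev_comp_inv _ _ _ _ _ _ (ev_rel_prec_arg _ _ _ _)) in H. revert y H.
    induction k as [|k IH]; intros y H.
    + apply ev_prec_0 in H. destruct (IHa _ _ H) as (L & HL & HLa). exists L.
      split; [exact HL|]. intros w Hw. apply ev_prec_0. auto.
    + apply ev_prec_S in H. destruct H as (r & Hr & Hy).
      apply (ev_comp_inv _ _ _ _ _ _ (ev_assoc _ _ _ _)) in Hy.
      destruct (IH _ Hr) as (L & HL & HLa), (IHb _ _ Hy) as (M & HM & HMb).
      exists (L ++ M). split.
      * intros m Hm. apply in_app_or in Hm. destruct Hm; auto.
      * intros w Hw. apply ev_prec_S. exists r.
        split; [apply HLa | apply HMb]; intros m Hm; apply Hw, in_or_app; auto.
  - destruct H as [H0 H1].
    apply (ev_comp_inv _ _ _ _ _ _ (ev_assoc _ _ _ _)) in H0.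
    destruct (IHa _ _ H0) as (L & HL & HLa).
    (* The search performs finitely many failing tests; their lists of questions are concatenated,
       one test at a time. *)
    assert (HN : forall j, j <= y ->
      exists N, (forall m, In m N -> exists v, ev o d (pr n m) v) /\
      forall w, (forall m, In m N -> ev o d (pr n m) (w m)) ->
      forall k, k < j -> exists v, ev w a (pr x k) (S v)).
    { intro j. induction j as [|j IH]; intro Hj.
      - exists nil. split; [easy | lia].
      - destruct IH as (N & HN & HNa); [lia|].
        destruct (H1 j Hj) as [v Hv].
        apply (ev_comp_inv _ _ _ _ _ _ (ev_assoc _ _ _ _)) in Hv.
        destruct (IHa _ _ Hv) as (M & HM & HMa). exists (M ++ N). split.
        + intros m Hm. apply in_app_or in Hm. destruct Hm; auto.
        + intros w Hw k Hk. destruct (Nat.eq_dec k j) as [->|Hne].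
          * exists v. apply HMa. intros m Hm. apply Hw, in_or_app. auto.
          * apply HNa; [|lia]. intros m Hm. apply Hw, in_or_app. auto. }
    destruct (HN y (le_n y)) as (N & HNd & HNa). exists (L ++ N). split.
    + intros m Hm. apply in_app_or in Hm. destruct Hm; auto.
    + intros w Hw. split.
      * apply HLa. intros m Hm. apply Hw, in_or_app. auto.
      * apply HNa. intros m Hm. apply Hw, in_or_app. auto.
Qed.

(** The converse of [ev_rel] comes from the use principle: [w] answers every question as [d] does,
    in particular those in the list. *)
Lemma ev_rel_total o d w n c x y :
  (forall m, ev o d (pr n m) (w m)) ->
  (ev o (rel d c) (pr n x) y <-> ev w c x y).
Proof.
  intro Hd. split; [|now apply ev_rel].
  intro H. destruct (ev_rel_use _ _ _ _ _ _ H) as (L & _ & HL). auto.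
Qed.

(** This is the use principle for a program [d] that merely forwards each question to the oracle;
    [k] exceeds every question in the resulting list. *)
Lemma ev_continuous o c x y :
  ev o c x y -> exists k, forall o', agree k o o' -> ev o' c x y.
Proof.
  intro H. pose (d := Comp Oracle Snd).
  assert (Hd : forall m, ev o d (pr 0 m) (o m)).
  { intro m. eapply ev_comp; [apply ev_Snd | reflexivity]. }
  apply (ev_rel _ _ _ _ Hd) in H.
  destruct (ev_rel_use _ _ _ _ _ _ H) as (L & _ & HL).
  exists (S (list_max L)). intros o' Ho. apply HL. intros m Hm.
  rewrite <- Ho; [apply Hd|]. pose proof (proj1 (list_max_le L (list_max L)) (le_n _)) as HM.
  rewrite Forall_forall in HM. specialize (HM m Hm). lia.
Qed.

Lemma Cf_continuous f o x :
  Cf f -> exists k, forall o', agree k o o' -> f o' x = f o x.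
Proof.
  intros [c Hc]. destruct (ev_continuous _ _ _ _ (Hc o x)) as [k Hk]. exists k.
  intros o' Ho. exact (ev_fun (Hc o' x) (Hk o' Ho)).
Qed.

(** A functional may be run on an oracle that is itself computed from a parameter, here [g o x];
    [rel] supplies the program. *)
Lemma Cf_subst f (w : baire -> nat -> baire) g h :
  Cf f -> Cf (fun o z => w o (p1 z) (p2 z)) -> Cf g -> Cf h ->
  Cf (fun o x => f (w o (g o x)) (h o x)).
Proof.
  intros [c Hc] [d Hd] Hg Hh.
  apply (Cf_app2 (fun o u v => f (w o u) v)); trivial.
  exists (rel d c). intros o x. rewrite <- (pr_eta x) at 1. apply ev_rel with (w := w o (p1 x)).
  - intro m. pose proof (Hd o (pr (p1 x) m)) as H. now rewrite p1_pr, p2_pr in H.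
  - apply Hc.
Qed.

(** * A universal stack machine *)

(** Quotient and remainder by 4, found by counting. [encode] numbers compound programs as 5 + i + 4
    * t with i < 4, so constructor and components are read off after subtracting 5. *)
Definition divmod4 (n : nat) : nat :=
  Nat.iter n (fun z => if p2 z =? 3 then pr (S (p1 z)) 0 else pr (p1 z) (S (p2 z))) (pr 0 0).

Lemma divmod4_spec q r : r < 4 -> divmod4 (r + 4 * q) = pr q r.
Proof.
  intro Hr. unfold divmod4.
  induction q as [|q IH].
  - destruct r as [|[|[|[|r]]]]; [..|lia]; cbn -[p1 p2 pr];
      repeat (rewrite ?p1_pr, ?p2_pr; cbn -[p1 p2 pr]); reflexivity.
  - replace (r + 4 * S q) with (4 + (r + 4 * q)) by lia.
    rewrite Nat.iter_add, IH.
    destruct r as [|[|[|[|r]]]]; [..|lia]; cbn -[p1 p2 pr];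
      repeat (rewrite ?p1_pr, ?p2_pr; cbn -[p1 p2 pr]); reflexivity.
Qed.

Definition eval_st (e x K : nat) : nat := pr 0 (pr e (pr x K)).
Definition ret_st (y K : nat) : nat := pr 1 (pr y K).
(** The successor distinguishes a nonempty stack from 0. Tags 0 and 4 wait for the first and second
    component of a [Pair], 1 for the inner program of a [Comp], 2 for the value of a recursion at
    its counter, 3 for the test of a [Mu] search. *)
Definition frame (tag D : nat) : nat := S (pr tag D).

Definition dispatch (e x K : nat) : nat :=
  let t := p1 (divmod4 (e - 5)) in
  let i := p2 (divmod4 (e - 5)) in
  if i =? 0 then eval_st (p1 t) x (frame 0 (pr (p2 t) (pr x K)))
  else if i =? 1 then eval_st (p2 t) x (frame 1 (pr (p1 t) K))
  else if i =? 2 then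
    eval_st (p1 t) (p1 x) (frame 2 (pr (p2 t) (pr (p1 x) (pr 0 (pr (p2 x) K)))))
  else eval_st t (pr x 0) (frame 3 (pr t (pr x (pr 0 K)))).

Definition return_to (y tag D s : nat) : nat :=
  if tag =? 0 then eval_st (p1 D) (p1 (p2 D)) (frame 4 (pr y (p2 (p2 D))))
  else if tag =? 1 then eval_st (p1 D) y (p2 D)
  else if tag =? 2 then
    (fun u k m K => if k =? m then ret_st y K
       else eval_st (p1 D) (pr u (pr k y)) (frame 2 (pr (p1 D) (pr u (pr (S k) (pr m K))))))
    (p1 (p2 D)) (p1 (p2 (p2 D))) (p1 (p2 (p2 (p2 D)))) (p2 (p2 (p2 (p2 D))))
  else if tag =? 3 then
    (fun x k K => if y =? 0 then ret_st k K
       else eval_st (p1 D) (pr x (S k)) (frame 3 (pr (p1 D) (pr x (pr (S k) K)))))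
    (p1 (p2 D)) (p1 (p2 (p2 D))) (p2 (p2 (p2 D)))
  else ret_st (pr (p1 D) y) (p2 D).

(** States are [eval_st e x K] (evaluate the program numbered [e] at [x]) and
    [ret_st y K] (return [y]), where [K] is the stack, [0] if empty; [a] is the
    answer of the oracle to the question [p1 (p2 (p2 s))]. *)
Definition step (a s : nat) : nat :=
  if p1 s =? 0 then
    (fun e x K =>
       if e =? 0 then ret_st 0 K
       else if e =? 1 then ret_st (S x) K
       else if e =? 2 then ret_st (p1 x) K
       else if e =? 3 then ret_st (p2 x) K
       else if e =? 4 then ret_st a K
       else dispatch e x K)
    (p1 (p2 s)) (p1 (p2 (p2 s))) (p2 (p2 (p2 s)))
  else
    (fun y K =>
      if K =? 0 then s else return_to y (p1 (Nat.pred K)) (p2 (Nat.pred K)) s)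
    (p1 (p2 s)) (p2 (p2 s)).

Definition stp (w : baire) (s : nat) : nat := step (w (p1 (p2 (p2 s)))) s.

(** [S y] if the machine returns [y] within [t] steps, else [0]. *)
Definition run (w : baire) (e x t : nat) : nat :=
  (fun s => if (p1 s =? 1) && (p2 (p2 s) =? 0) then S (p1 (p2 s)) else 0)%bool
  (Nat.iter t (stp w) (eval_st e x 0)).

Lemma Cf_divmod4 f : Cf f -> Cf (fun o x => divmod4 (f o x)).
Proof. intro Hf. apply (Cf_iter f (fun _ _ z =>
    if p2 z =? 3 then pr (S (p1 z)) 0 else pr (p1 z) (S (p2 z)))); cf. Qed.

Lemma Cf_run (w : baire -> nat -> baire) e x t :
  Cf (fun o z => w o (p1 z) (p2 z)) -> Cf e -> Cf x -> Cf t ->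
  Cf (fun o z => run (w o z) (e o z) (x o z) (t o z)).
Proof.
  intros Hw He Hx Ht. unfold run. cbv beta.
  assert (Hit : Cf (fun o z => Nat.iter (t o z) (stp (w o z)) (eval_st (e o z) (x o z) 0))).
  { apply (Cf_iter t (fun o z => stp (w o z))); trivial; [|unfold eval_st; cf].
    unfold stp. assert (Hq : Cf (fun o z => w o (p1 z) (p1 (p2 (p2 (p2 z)))))).
    { apply (Cf_app2 w); cf. }
    unfold step, dispatch, return_to, frame, eval_st, ret_st. cbv beta zeta.
    repeat lazymatch goal with
           | |- Cf (fun o z => divmod4 (@?f o z)) => apply Cf_divmod4
           | _ => cf_step
           end. }
  cf.
Qed.

(** * Correctness of the stack machine *)

Section Machine.
Variable w : baire.

(** A return state with empty stack is a fixed point of the machine, so this amounts to halting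
    within [N] steps. *)
Definition lands (N s y : nat) : Prop := Nat.iter N (stp w) s = ret_st y 0.

Lemma lands_S N s y : lands (S N) s y <-> lands N (stp w s) y.
Proof. unfold lands. now rewrite Nat.iter_succ_r. Qed.

Lemma lands_R0 N y z : lands N (ret_st y 0) z <-> z = y.
Proof.
  assert (H : stp w (ret_st y 0) = ret_st y 0).
  { unfold stp, step, ret_st. repeat (rewrite ?p1_pr, ?p2_pr). reflexivity. }
  assert (HN : Nat.iter N (stp w) (ret_st y 0) = ret_st y 0).
  { induction N as [|N IH]; [reflexivity|]. now rewrite Nat.iter_succ, IH. }
  unfold lands. rewrite HN. split; [|now intros ->].
  intro HR. apply (f_equal (fun s => p1 (p2 s))) in HR. unfold ret_st in HR.
  now rewrite !p2_pr, !p1_pr in HR.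
Qed.

Lemma run_lands e x t y : run w e x t = S y <-> lands t (eval_st e x 0) y.
Proof.
  unfold run, lands. cbv beta. generalize (Nat.iter t (stp w) (eval_st e x 0)) as s. intro s.
  split.
  - destruct (Nat.eqb_spec (p1 s) 1) as [H1|], (Nat.eqb_spec (p2 (p2 s)) 0) as [H2|];
      try discriminate. cbn [andb]. intro H. injection H as H. unfold ret_st.
    now rewrite <- (pr_eta s), <- (pr_eta (p2 s)), H1, H2, H.
  - intros ->. unfold ret_st. repeat (rewrite ?p1_pr, ?p2_pr). reflexivity.
Qed.

Ltac compute_step :=
  unfold stp, step, return_to, dispatch, frame, eval_st, ret_st; cbv beta zeta;
  repeat (rewrite ?p1_pr, ?p2_pr, ?Nat.pred_succ; cbn [Nat.eqb]); reflexivity.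

Lemma stp_basic c x K : match c with
  | Zero => stp w (eval_st (encode c) x K) = ret_st 0 K
  | Succ => stp w (eval_st (encode c) x K) = ret_st (S x) K
  | Fst => stp w (eval_st (encode c) x K) = ret_st (p1 x) K
  | Snd => stp w (eval_st (encode c) x K) = ret_st (p2 x) K
  | Oracle => stp w (eval_st (encode c) x K) = ret_st (w x) K
  | _ => True
  end.
Proof. destruct c; trivial; cbn [encode]; compute_step. Qed.

Lemma stp_dispatch e x K : 5 <= e -> stp w (eval_st e x K) = dispatch e x K.
Proof.
  intro He. unfold stp, step, eval_st. cbv beta.
  repeat (rewrite ?p1_pr, ?p2_pr; cbn [Nat.eqb]).
  do 5 (destruct e as [|e]; [lia|]). reflexivity.
Qed.

Ltac compute_dispatch r :=
  cbn [encode]; rewrite stp_dispatch by lia; unfold dispatch;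
  match goal with |- context [divmod4 (_ + 4 * ?t - 5)] =>
    replace (_ + 4 * t - 5) with (r + 4 * t) by lia;
    rewrite (divmod4_spec t r) by lia
  end;
  rewrite !p1_pr, !p2_pr; cbn [Nat.eqb].

Lemma stp_Pair a b x K :
  stp w (eval_st (encode (Pair a b)) x K) = eval_st (encode a) x (frame 0 (pr (encode b) (pr x K))).
Proof.
  compute_dispatch 0.
  change (to_nat (encode a, encode b)) with (pr (encode a) (encode b)).
  now rewrite p1_pr, p2_pr.
Qed.

Lemma stp_Comp a b x K :
  stp w (eval_st (encode (Comp a b)) x K) = eval_st (encode b) x (frame 1 (pr (encode a) K)).
Proof.
  compute_dispatch 1.
  change (to_nat (encode a, encode b)) with (pr (encode a) (encode b)).
  now rewrite p1_pr, p2_pr.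
Qed.

Lemma stp_Prec a b u n K :
  stp w (eval_st (encode (Prec a b)) (pr u n) K) =
  eval_st (encode a) u (frame 2 (pr (encode b) (pr u (pr 0 (pr n K))))).
Proof.
  compute_dispatch 2.
  change (to_nat (encode a, encode b)) with (pr (encode a) (encode b)).
  now rewrite !p1_pr, !p2_pr.
Qed.

Lemma stp_Mu a x K :
  stp w (eval_st (encode (Mu a)) x K) =
  eval_st (encode a) (pr x 0) (frame 3 (pr (encode a) (pr x (pr 0 K)))).
Proof. now compute_dispatch 3. Qed.

Lemma stp_frame0 y e x K :
  stp w (ret_st y (frame 0 (pr e (pr x K)))) = eval_st e x (frame 4 (pr y K)).
Proof. compute_step. Qed.

Lemma stp_frame1 y e K : stp w (ret_st y (frame 1 (pr e K))) = eval_st e y K.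
Proof. compute_step. Qed.

Lemma stp_frame2 y e u k m K :
  stp w (ret_st y (frame 2 (pr e (pr u (pr k (pr m K)))))) =
  if k =? m then ret_st y K
  else eval_st e (pr u (pr k y)) (frame 2 (pr e (pr u (pr (S k) (pr m K))))).
Proof. compute_step. Qed.

Lemma stp_frame3 y e x k K :
  stp w (ret_st y (frame 3 (pr e (pr x (pr k K))))) =
  if y =? 0 then ret_st k K else eval_st e (pr x (S k)) (frame 3 (pr e (pr x (pr (S k) K)))).
Proof. compute_step. Qed.

Lemma stp_frame4 y u K : stp w (ret_st y (frame 4 (pr u K))) = ret_st (pr u y) K.
Proof. compute_step. Qed.

Lemma lands_E N e x K z :
  lands N (eval_st e x K) z -> exists M, N = S M /\ lands M (stp w (eval_st e x K)) z.
Proof.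
  destruct N as [|N].
  - intro H. apply (f_equal p1) in H. change (p1 (eval_st e x K) = p1 (ret_st z 0)) in H.
    unfold eval_st, ret_st in H. rewrite !p1_pr in H. discriminate.
  - exists N. split; trivial. now apply lands_S.
Qed.

Lemma lands_frame N y tag D z :
  lands N (ret_st y (frame tag D)) z ->
  exists M, N = S M /\ lands M (stp w (ret_st y (frame tag D))) z.
Proof.
  destruct N as [|N].
  - intro H. apply (f_equal (fun s => p2 (p2 s))) in H.
    change (p2 (p2 (ret_st y (frame tag D))) = p2 (p2 (ret_st z 0))) in H.
    unfold ret_st in H. rewrite !p2_pr in H. discriminate.
  - exists N. split; trivial. now apply lands_S.
Qed.

Lemma lands_step N s s' z : stp w s = s' -> lands N s' z -> lands (S N) s z.
Proof. intros <-. apply lands_S. Qed.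

(** Continuation-passing form: the stack [K] is arbitrary and the run after returning [y] is assumed
    to land. The induction then goes through without adding up step counts. *)
Lemma machine_complete c : forall x y K z,
  ev w c x y -> (exists N, lands N (ret_st y K) z) -> exists N, lands N (eval_st (encode c) x K) z.
Proof.
  assert (Hst : forall s s' z, stp w s = s' ->
    (exists N, lands N s' z) -> exists N, lands N s z).
  { intros s s' z Hs [N HN]. exists (S N). now apply lands_step with s'. }
  induction c as [ | | | | |a IHa b IHb|a IHa b IHb|a IHa b IHb|a IHa]; intros x y K z H HK.
  - apply Hst with (1 := stp_basic Zero x K). now rewrite <- H.
  - apply Hst with (1 := stp_basic Succ x K). now rewrite <- H.
  - apply Hst with (1 := stp_basic Fst x K). unfold p1. now rewrite <- H.
  - apply Hst with (1 := stp_basic Snd x K). unfold p2. now rewrite <- H.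
  - apply Hst with (1 := stp_basic Oracle x K). now rewrite <- H.
  - destruct H as (u & v & Hu & Hv & ->). apply Hst with (1 := stp_Pair a b x K).
    apply IHa with u; trivial. apply Hst with (1 := stp_frame0 _ _ _ _).
    apply IHb with v; trivial. now apply Hst with (1 := stp_frame4 _ _ _).
  - destruct H as (u & Hu & Hv). apply Hst with (1 := stp_Comp a b x K).
    apply IHb with u; trivial. apply Hst with (1 := stp_frame1 _ _ _).
    now apply IHa with y.
  - rewrite <- (pr_eta x) in *. revert H. generalize (p1 x) as u, (p2 x) as m. intros u m H.
    apply Hst with (1 := stp_Prec a b u m K).
    (* A landing run that starts by returning the value at [k] is extended backwards to the start of
       the recursion. *)
    assert (Hk : forall k r, k <= m -> ev w (Prec a b) (pr u k) r ->
      (exists N, lands N (ret_st r (frame 2 (pr (encode b) (pr u (pr k (pr m K)))))) z) ->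
      exists N, lands N (eval_st (encode a) u (frame 2 (pr (encode b) (pr u (pr 0 (pr m K)))))) z).
    { intro k. induction k as [|k IH]; intros r Hk Hr HN.
      - apply ev_prec_0 in Hr. now apply IHa with r.
      - apply ev_prec_S in Hr. destruct Hr as (r' & Hr' & Hr).
        apply IH with r'; [lia | trivial|].
        apply Hst with (1 := stp_frame2 _ _ _ _ _ _).
        destruct (Nat.eqb_spec k m); [lia|]. now apply IHb with r. }
    apply Hk with m y; trivial. apply Hst with (1 := stp_frame2 _ _ _ _ _ _).
    now rewrite Nat.eqb_refl.
  - destruct H as [H0 H1]. apply Hst with (1 := stp_Mu a x K).
    (* [j] counts the tests that still fail before the search reaches [y]. *)
    assert (Hk : forall j k, k + j = y ->
      exists N, lands N (eval_st (encode a) (pr x k) (frame 3 (pr (encode a) (pr x (pr k K))))) z).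
    { intro j. induction j as [|j IH]; intros k Hk.
      - replace k with y by lia. apply IHa with 0; trivial.
        now apply Hst with (1 := stp_frame3 _ _ _ _ _).
      - destruct (H1 k) as [v Hv]; [lia|]. apply IHa with (S v); trivial.
        apply Hst with (1 := stp_frame3 _ _ _ _ _). apply IH. lia. }
    apply (Hk y). reflexivity.
Qed.

(** The bound [M <= N] is carried along for the sake of [Mu]: the number of rounds of a search is
    not known in advance, so that case is an induction on the remaining steps. *)
Lemma machine_sound c : forall N x K z,
  lands N (eval_st (encode c) x K) z -> exists y M, M <= N /\ ev w c x y /\ lands M (ret_st y K) z.
Proof.
  induction c as [ | | | | |a IHa b IHb|a IHa b IHb|a IHa b IHb|a IHa]; intros N x K z H;
    destruct (lands_E _ _ _ _ _ H) as (M & -> & HM).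
  - rewrite (stp_basic Zero) in HM. exists 0, M. repeat split; auto.
  - rewrite (stp_basic Succ) in HM. exists (S x), M. repeat split; auto.
  - rewrite (stp_basic Fst) in HM. exists (p1 x), M. repeat split; auto.
  - rewrite (stp_basic Snd) in HM. exists (p2 x), M. repeat split; auto.
  - rewrite (stp_basic Oracle) in HM. exists (w x), M. repeat split; auto.
  - rewrite stp_Pair in HM. apply IHa in HM. destruct HM as (u & M1 & L1 & Hu & H1).
    apply lands_frame in H1. destruct H1 as (M2 & -> & H2). rewrite stp_frame0 in H2.
    apply IHb in H2. destruct H2 as (v & M3 & L3 & Hv & H3).
    apply lands_frame in H3. destruct H3 as (M4 & -> & H4). rewrite stp_frame4 in H4.
    exists (pr u v), M4. repeat split; [lia | now apply ev_pair | exact H4].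
  - rewrite stp_Comp in HM. apply IHb in HM. destruct HM as (u & M1 & L1 & Hu & H1).
    apply lands_frame in H1. destruct H1 as (M2 & -> & H2). rewrite stp_frame1 in H2.
    apply IHa in H2. destruct H2 as (v & M3 & L3 & Hv & H3).
    exists v, M3. repeat split; [lia | now apply ev_comp with u | exact H3].
  - rewrite <- (pr_eta x) in *. revert HM. generalize (p1 x) as u, (p2 x) as m. intros u m HM.
    clear H. rewrite stp_Prec in HM. apply IHa in HM. destruct HM as (r & M1 & L1 & Hr & H1).
    apply (ev_prec_0 _ a b) in Hr.
    assert (Hk : forall j k, k + j = m -> forall r M1, ev w (Prec a b) (pr u k) r ->
      lands M1 (ret_st r (frame 2 (pr (encode b) (pr u (pr k (pr m K)))))) z ->
      exists y M', M' <= M1 /\ ev w (Prec a b) (pr u m) y /\ lands M' (ret_st y K) z).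
    { clear - IHb. intro j. induction j as [|j IH]; intros k Hk r M1 Hr H1;
        apply lands_frame in H1; destruct H1 as (M2 & -> & H2); rewrite stp_frame2 in H2.
      - replace k with m in * by lia. rewrite Nat.eqb_refl in H2.
        exists r, M2. repeat split; auto.
      - destruct (Nat.eqb_spec k m); [lia|]. apply IHb in H2.
        destruct H2 as (v & M3 & L3 & Hv & H3).
        destruct (IH (S k)) with (r := v) (M1 := M3) as (y & M' & L' & Hy & H'); trivial;
          [lia | | exists y, M'; repeat split; trivial; lia].
        apply ev_prec_S. now exists r. }
    destruct (Hk m 0 eq_refl r M1 Hr H1) as (y & M' & L' & Hy & H').
    exists y, M'. repeat split; trivial. lia.
  - rewrite stp_Mu in HM. clear H.
    assert (Hk : forall M k, (forall i, i < k -> exists v, ev w a (pr x i) (S v)) ->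
      lands M (eval_st (encode a) (pr x k) (frame 3 (pr (encode a) (pr x (pr k K))))) z ->
      exists y M', M' <= M /\ ev w (Mu a) x y /\ lands M' (ret_st y K) z).
    { clear - IHa. intro M. induction M as [M IH] using lt_wf_ind. intros k Hk HM.
      apply IHa in HM. destruct HM as (v & M1 & L1 & Hv & H1).
      apply lands_frame in H1. destruct H1 as (M2 & -> & H2). rewrite stp_frame3 in H2.
      destruct v as [|v]; cbn [Nat.eqb] in H2.
      - exists k, M2. repeat split; trivial. lia.
      - assert (Hk' : forall i, i < S k -> exists v, ev w a (pr x i) (S v)).
        { intros i Hi. destruct (Nat.eq_dec i k) as [->|Hne]; [now exists v | apply Hk; lia]. }
        destruct (IH M2 L1 (S k) Hk' H2) as (y & M' & L' & Hy & H').
        exists y, M'. split; [lia | split; assumption]. }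
    destruct (Hk M 0) as (y & M' & L' & Hy & H'); [lia | exact HM|].
    exists y, M'. split; [lia | split; assumption].
Qed.

Lemma run_sound c x t y : run w (encode c) x t = S y -> ev w c x y.
Proof.
  intro H. apply run_lands in H. apply machine_sound in H.
  destruct H as (y' & M & _ & Hy & HM). apply lands_R0 in HM. now subst y'.
Qed.

Lemma run_complete c x y : ev w c x y -> exists t, run w (encode c) x t = S y.
Proof.
  intro H. destruct (machine_complete c x y 0 y H) as [t Ht].
  - exists 0. now apply lands_R0.
  - exists t. now apply run_lands.
Qed.

End Machine.

(** * Searching, halting, and computably enumerable sets *)

Definition shift (p : baire) : baire := fun m => p (S m).

Lemma Cf_join (p q : baire -> nat -> baire) g :
  Cf (fun o z => p o (p1 z) (p2 z)) -> Cf (fun o z => q o (p1 z) (p2 z)) -> Cf g ->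
  Cf (fun o z => join (p o z) (q o z) (g o z)).
Proof.
  intros Hp Hq Hg. unfold join. apply Cf_if.
  - cf.
  - apply (Cf_app2 p); cf.
  - apply (Cf_app2 q); cf.
Qed.

Lemma least_true (b : nat -> bool) t :
  b t = true -> exists s, b s = true /\ forall k, k < s -> b k = false.
Proof.
  intro Ht. destruct (dec_inh_nat_subset_has_unique_least_element (fun k => b k = true))
    as [s [[Hs Hl] _]]; [|now exists t|].
  - intro k. destruct (b k); auto.
  - exists s. split; trivial. intros k Hk. destruct (b k) eqn:E; trivial.
    specialize (Hl k E). lia.
Qed.

Lemma search_code (b : baire -> nat -> nat -> bool) :
  Cfb (fun o z => b o (p1 z) (p2 z)) ->
  exists c, forall o x y, b o x y = true -> (forall k, k < y -> b o x k = false) ->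
    ev o c x y.
Proof.
  intro Hb. assert (Hn : Cf (fun o z => if b o (p1 z) (p2 z) then 0 else 1)) by cf.
  destruct Hn as [c Hc]. exists (Mu c). intros o x y Hy Hk. split.
  - pose proof (Hc o (pr x y)) as H. now rewrite p1_pr, p2_pr, Hy in H.
  - intros k Hlt. exists 0. pose proof (Hc o (pr x k)) as H.
    now rewrite p1_pr, p2_pr, (Hk k Hlt) in H.
Qed.

(** A stage is a number of steps of the universal machine. With the converse below, obtained by
    unbounded search, halting of partial programs is traded for total stage predicates, uniformly in
    the oracle. *)
Lemma halting_stage c : exists b : baire -> nat -> nat -> bool,
  Cfb (fun o z => b o (p1 z) (p2 z)) /\
  forall o x, (exists y, ev o c x y) <-> exists t, b o x t = true.
Proof.
  exists (fun o x t => negb (run o (encode c) x t =? 0)). split.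
  - assert (H : Cf (fun o z => run o (encode c) (p1 z) (p2 z))).
    { apply (Cf_run (fun o _ => o)); cf. }
    cf.
  - intros o x. split.
    + intros [y Hy]. destruct (run_complete _ _ _ _ Hy) as [t Ht]. exists t. now rewrite Ht.
    + intros [t Ht]. destruct (run o (encode c) x t) as [|y] eqn:E; [discriminate|].
      exists y. exact (run_sound _ _ _ _ _ E).
Qed.

Lemma stage_halting (b : baire -> nat -> nat -> bool) :
  Cfb (fun o z => b o (p1 z) (p2 z)) ->
  exists c, forall o x, (exists y, ev o c x y) <-> exists t, b o x t = true.
Proof.
  intro Hb. assert (Hn : Cf (fun o z => if b o (p1 z) (p2 z) then 0 else 1)) by cf.
  destruct Hn as [c Hc].
  assert (Hc' : forall o x t, ev o c (pr x t) (if b o x t then 0 else 1)).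
  { intros o x t. pose proof (Hc o (pr x t)) as H. now rewrite p1_pr, p2_pr in H. }
  exists (Mu c). intros o x. split.
  - intros [y [Hy _]]. exists y. pose proof (ev_fun Hy (Hc' o x y)) as H.
    now destruct (b o x y).
  - intros [t Ht]. destruct (least_true _ _ Ht) as (s & Hs & Hl). exists s. split.
    + pose proof (Hc' o x s) as H. now rewrite Hs in H.
    + intros k Hk. exists 0. pose proof (Hc' o x k) as H. now rewrite (Hl k Hk) in H.
Qed.

Lemma ce_stage (B : nat -> Prop) : ce B <->
  exists b : nat -> nat -> bool,
    Cfb (fun _ z => b (p1 z) (p2 z)) /\ forall n, B n <-> exists t, b n t = true.
Proof.
  split.
  - intros [c Hc]. destruct (halting_stage c) as (b & Hb & Hbs).
    exists (b (fun _ => 0)). split.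
    (* The stage predicate may consult its oracle; fixing that oracle to the zero sequence makes it
       a predicate of numbers alone. *)
    + apply (Cf_subst (fun o z => if b o (p1 z) (p2 z) then 1 else 0)
               (fun _ _ _ => 0) (fun _ _ => 0) (fun _ z => z)); trivial; cf.
    + intro n. rewrite Hc. apply Hbs.
  - intros (b & Hb & Hbs). destruct (stage_halting (fun _ => b) Hb) as [c Hc].
    exists c. intro n. rewrite Hbs. symmetry. apply Hc.
Qed.

(** * Names of open subsets of [S_ A] *)

Section Names.
Variable A : nat -> Prop.

(** The index determines the Sierpinski coordinate, so points and open sets of [S_ A] are handled as
    numbers and sets of numbers from here on. *)
Definition idx (x : S_ A) : nat := fst (proj1_sig x).

Definition is_name (q : baire) (n : nat) : Prop :=
  q 0 = n /\ (A n <-> exists j, q (2 * j + 1) <> 0).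

Lemma names_S_A (x : S_ A) q : names q x <-> is_name q (idx x).
Proof.
  destruct x as [[n s] Hx]. unfold idx, is_name. cbn [proj1_sig fst].
  change (names q (exist _ (n, s) Hx : S_ A)) with
    (names (evens q) (n : nat_space) /\ names (odds q) (s : sierp)).
  change (names (evens q) (n : nat_space)) with (q 0 = n).
  assert (Hs : s = top <-> A n).
  { destruct Hx as [(m & Hm & E)|(m & Hm & E)]; injection E as -> ->; split; easy. }
  destruct s; cbn.
  - assert (HA : A n) by now apply Hs. split; intros [H0 H]; split; trivial.
    + split; trivial. intros _. apply not_all_ex_not. exact H.
    + intro Hall. apply H in HA. destruct HA as [j Hj]. apply Hj, Hall.
  - assert (HA : ~ A n) by (intro HA; now apply Hs in HA).
    split; intros [H0 H]; split; trivial.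
    + split; [easy | intros [j Hj]; now contradiction (Hj (H j))].
    + intro j. apply NNPP. intro Hj. apply HA, H. now exists j.
Qed.

Lemma idx_inj x y : idx x = idx y -> x = y.
Proof.
  intro H. destruct (names_surj x) as [p Hp]. apply (names_fun Hp).
  apply names_S_A. rewrite <- H. now apply names_S_A.
Qed.

Lemma idx_surj n : exists x, idx x = n.
Proof.
  destruct (classic (A n)) as [H|H].
  - unshelve eexists.
    + exists (n, top). left. now exists n.
    + reflexivity.
  - unshelve eexists.
    + exists (n, bot). right. now exists n.
    + reflexivity.
Qed.

Lemma in_open_idx (W : opens (S_ A)) x :
  in_open W x <-> exists y, idx y = idx x /\ in_open W y.
Proof.
  split; [intro Hx; now exists x|]. intros (y & Hy & HW). now rewrite <- (idx_inj _ _ Hy).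
Qed.

(** [p] is a name of the open set of all points whose index is in [U]. *)
Definition codes (p : baire) (U : nat -> Prop) : Prop :=
  forall q n, is_name q n -> exists r, coded p q r /\ ((exists j, r j <> 0) <-> U n).

Lemma names_sierp (r : baire) (s : sierp) :
  names r s <-> ((exists j, r j <> 0) <-> s = top).
Proof.
  destruct s; cbn; split.
  - intro H. split; trivial. intros _. now apply not_all_ex_not.
  - intros H Hall. destruct (proj2 H eq_refl) as [j Hj]. auto.
  - intro H. split; [|discriminate]. intros [j Hj]. now contradiction (Hj (H j)).
  - intros H j. apply NNPP. intro Hj. enough (bot = top) by discriminate.
    apply H. now exists j.
Qed.

Lemma codes_of_names p (U : opens (S_ A)) (P : nat -> Prop) :
  names p U -> (forall x, in_open U x <-> P (idx x)) -> codes p P.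
Proof.
  intros Hp HU q n Hq. destruct (idx_surj n) as [x <-].
  destruct (Hp x q) as (r & y & Hr & Hy & Hn).
  - now exists (proj1_sig U x).
  - now apply names_S_A.
  - unfold single in Hy. subst y. exists r. split; [exact Hr|].
    rewrite <- HU. now apply names_sierp.
Qed.

Lemma coded_continuous p : pmap_continuous (coded p).
Proof.
  intros q r (c & Hc & H) n.
  assert (Hn : exists k, forall q', agree k q q' ->
    forall i, i < n -> ev (join (fun m => p (S m)) q') c i (r i)).
  { induction n as [|n [k Hk]].
    - exists 0. intros; lia.
    - destruct (ev_continuous _ _ _ _ (H n)) as [l Hl]. exists (k + l).
      intros q' Hq i Hi. destruct (Nat.eq_dec i n) as [->|Hne].
      + apply Hl. intros m Hm. unfold join.
        destruct (Nat.even m); trivial. apply Hq.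
        pose proof (Nat.div2_decr m m (Nat.le_succ_diag_r m)). lia.
      + apply Hk; [|lia]. intros m Hm. apply Hq. lia. }
  destruct Hn as [k Hk]. exists k. intros q' r' (c' & Hc' & H') Hq i Hi.
  rewrite Hc in Hc'. apply encode_inj in Hc'. subst c'.
  exact (ev_fun (Hk q' Hq i Hi) (H' i)).
Qed.

(** The characteristic function is chosen classically. It is a point of the function space because
    the map coded by [p] realises it and coded maps are continuous. *)
Lemma names_of_codes p (P : nat -> Prop) :
  codes p P -> exists U : opens (S_ A), names p U /\ forall x, in_open U x <-> P (idx x).
Proof.
  intro Hp.
  pose (f := fun x : S_ A => if excluded_middle_informative (P (idx x)) then top else bot).
  assert (Hf : forall x, f x = top <-> P (idx x)).
  { intro x. unfold f. now destruct (excluded_middle_informative (P (idx x))). }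
  assert (Hr : @realiser (S_ A) sierp (coded p) (single (Y := sierp) f)).
  { intros x q _ Hq. apply names_S_A in Hq. destruct (Hp q _ Hq) as (r & Hr & H).
    exists r, (f x). split; [exact Hr|]. split; [reflexivity|].
    apply names_sierp. now rewrite Hf. }
  assert (Hc : @continuously_realisable (S_ A) sierp (single (Y := sierp) f)).
  { exists (coded p). split; [apply coded_continuous | exact Hr]. }
  exists (exist _ f Hc). split; [exact Hr | exact Hf].
Qed.

(** Closed sets are named by their open complements: disjointness becomes a cover by [O1] and [O2],
    and inclusion of a closed set in [U] becomes the alternative [U n \/ O1 n]. *)
Lemma norm_code :
  computably_normal (S_ A) ->
  exists c, forall P O1 O2, codes (evens P) O1 -> codes (odds P) O2 ->
    (forall n, O1 n \/ O2 n) ->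
    exists Q U V, (forall m, ev P c m (Q m)) /\ codes (evens Q) U /\ codes (odds Q) V /\
      (forall n, ~ (U n /\ V n)) /\ (forall n, U n \/ O1 n) /\ (forall n, V n \/ O2 n).
Proof.
  intros [Hdom (G & [c Hc] & HG)]. exists c. intros P O1 O2 H1 H2 H12.
  destruct (names_of_codes _ _ H1) as (W1 & HW1 & HO1).
  destruct (names_of_codes _ _ H2) as (W2 & HW2 & HO2).
  pose (compl := fun W : opens (S_ A) =>
    exist (fun C : S_ A -> Prop => exists U : opens (S_ A), forall x, C x <-> ~ in_open U x)
      (fun x => ~ in_open W x) (ex_intro _ W (fun x => iff_refl _)) : closeds (S_ A)).
  destruct (HG (compl W1, compl W2) P) as (Q & [U V] & HQ & (HD & HU & HV) & [HNU HNV]).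
  - apply Hdom. intros x [Hx1 Hx2]. cbn in Hx1, Hx2.
    destruct (H12 (idx x)) as [H|H]; [apply Hx1, HO1, H | apply Hx2, HO2, H].
  - split; [exists W1 | exists W2]; split; trivial; intro x; reflexivity.
  - cbn [fst snd] in *.
    exists Q, (fun n => exists y, idx y = n /\ in_open U y),
      (fun n => exists y, idx y = n /\ in_open V y).
    split; [exact (Hc P Q HQ)|].
    split; [apply codes_of_names with U; [assumption | intro; apply in_open_idx]|].
    split; [apply codes_of_names with V; [assumption | intro; apply in_open_idx]|].
    repeat split; intro n.
    + intros [(x & Hx & HUx) (y & Hy & HVy)]. rewrite <- Hy in Hx. apply idx_inj in Hx.
      subst y. exact (HD x (conj HUx HVy)).
    + destruct (idx_surj n) as [x <-]. destruct (classic (O1 (idx x))) as [H|H]; [now right|].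
      left. exists x. split; trivial. apply HU. intro Hx. apply H, HO1, Hx.
    + destruct (idx_surj n) as [x <-]. destruct (classic (O2 (idx x))) as [H|H]; [now right|].
      left. exists x. split; trivial. apply HV. intro Hx. apply H, HO2, Hx.
Qed.

(** The prescribed domain of [Norm] comes for free: every pair of closed sets has a name, and on
    names of disjoint pairs [F] produces a separation. *)
Lemma normal_of_functional (F : baire -> baire) :
  Cf F ->
  (forall P O1 O2, codes (evens P) O1 -> codes (odds P) O2 ->
    (forall n, O1 n \/ O2 n) ->
    exists U V, codes (evens (F P)) U /\ codes (odds (F P)) V /\
      (forall n, ~ (U n /\ V n)) /\ (forall n, U n \/ O1 n) /\ (forall n, V n \/ O2 n)) ->
  computably_normal (S_ A).
Proof.
  intros HF HN.
  assert (Hmain : forall (AB : prod_space (closeds (S_ A)) (closeds (S_ A))) P, names P AB ->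
    (forall x, ~ (in_closed (fst AB) x /\ in_closed (snd AB) x)) ->
    exists UV, Norm AB UV /\ names (F P) UV).
  { intros [C1 C2] P [(W1 & HW1 & HC1) (W2 & HW2 & HC2)] HD.
    cbn [fst snd] in *. unfold in_closed in HD.
    destruct (HN P (fun n => exists y, idx y = n /\ in_open W1 y)
      (fun n => exists y, idx y = n /\ in_open W2 y)) as (U & V & HU & HV & HUV & H1 & H2).
    - apply codes_of_names with W1; [assumption | intro; apply in_open_idx].
    - apply codes_of_names with W2; [assumption | intro; apply in_open_idx].
    - intro n. destruct (idx_surj n) as [x <-]. apply NNPP. intro Hn.
      apply (HD x). split; [apply HC1 | apply HC2]; intro Hx; apply Hn;
        [left | right]; now exists x.
    - destruct (names_of_codes _ _ HU) as (U' & HU' & EU).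
      destruct (names_of_codes _ _ HV) as (V' & HV' & EV).
      exists (U', V'). split; [|now split]. split; [|split]; intro x; cbn [fst snd].
      + rewrite EU, EV. apply HUV.
      + intro Hx. apply EU. destruct (H1 (idx x)) as [H|H]; trivial.
        apply in_open_idx in H. now apply HC1 in Hx.
      + intro Hx. apply EV. destruct (H2 (idx x)) as [H|H]; trivial.
        apply in_open_idx in H. now apply HC2 in Hx. }
  assert (Hdom : forall AB, dom (@Norm (S_ A)) AB <->
    forall x, ~ (in_closed (fst AB) x /\ in_closed (snd AB) x)).
  { intro AB. split.
    - intros [UV (H1 & H2 & H3)] x [Ha Hb]. apply (H1 x). auto.
    - intro HD. destruct (names_surj AB) as [P HP].
      destruct (Hmain AB P HP HD) as (UV & HUV & _). now exists UV. }
  split; [exact Hdom|].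
  exists {| pgraph := fun p q => q = F p;
            pgraph_fun := fun p q r Hq Hr => eq_trans Hq (eq_sym Hr) |}.
  split.
  - destruct HF as [c Hc]. exists c. intros p q ->. apply Hc.
  - intros AB P HD HP.
    destruct (Hmain AB P HP (proj1 (Hdom AB) HD)) as (UV & HUV & HF'). exists (F P), UV.
    split; [reflexivity | split; assumption].
Qed.

(** * Semidecidability of membership *)

(** A stage codes an output place and a running time. As [run] returns the successor of the output,
    a value above 1 is a nonzero output, that is, a proof of membership. *)
Definition accept (p q : baire) (t : nat) : bool :=
  1 <? run (join (shift p) q) (p 0) (p1 t) (p2 t).

Lemma accept_spec p U q n :
  codes p U -> is_name q n -> (U n <-> exists t, accept p q t = true).
Proof.
  intros Hp Hq. destruct (Hp q n Hq) as (r & (c & Hc & Hr) & HU). rewrite <- HU.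
  unfold accept. rewrite Hc. split.
  - intros [j Hj]. destruct (run_complete _ _ _ _ (Hr j)) as [t Ht].
    exists (pr j t). rewrite p1_pr, p2_pr. unfold shift. rewrite Ht.
    apply Nat.ltb_lt. lia.
  - intros [t Ht]. apply Nat.ltb_lt in Ht. exists (p1 t).
    destruct (run (join (shift p) q) (encode c) (p1 t) (p2 t)) as [|v] eqn:E; [lia|].
    apply run_sound in E. rewrite (ev_fun (Hr (p1 t)) E). lia.
Qed.

Lemma Cfb_accept (p q : baire -> nat -> baire) t :
  Cf (fun o z => p o (p1 z) (p2 z)) -> Cf (fun o z => q o (p1 z) (p2 z)) -> Cf t ->
  Cfb (fun o z => accept (p o z) (q o z) (t o z)).
Proof.
  intros Hp Hq Ht. unfold accept.
  assert (Hr : Cf (fun o z =>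
    run (join (shift (p o z)) (q o z)) (p o z 0) (p1 (t o z)) (p2 (t o z)))).
  { apply (Cf_run (fun o z => join (shift (p o z)) (q o z))); [| |cf|cf].
    - apply (Cf_join (fun o z => shift (p o (p1 z))) (fun o z => q o (p1 z))); [| |cf].
      + apply (Cf_app2 p); cf.
      + apply (Cf_app2 q); cf.
    - apply (Cf_app2 p); cf. }
  cf.
Qed.

End Names.

(** * Canonical names, finite prefixes and least witnesses *)

Definition point (n b : nat) : baire := fun i => if i =? 0 then n else b.

Lemma is_name_top (A : nat -> Prop) n : A n -> is_name A (point n 1) n.
Proof. intro H. split; [reflexivity|]. split; trivial. intros _. now exists 0. Qed.

Lemma is_name_bot (A : nat -> Prop) n : ~ A n -> is_name A (point n 0) n.
Proof.
  intro H. split; [reflexivity|]. split; [easy|]. intros [j Hj]. exfalso. apply Hj.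
  unfold point. now replace (2 * j + 1) with (S (2 * j)) by lia.
Qed.

Lemma agree_join_r k p q q' : agree k q q' -> agree k (join p q) (join p q').
Proof.
  intros H i Hi. unfold join. destruct (Nat.even i); trivial. apply H.
  pose proof (Nat.div2_decr i i (Nat.le_succ_diag_r i)). lia.
Qed.

Lemma agree_join_l k p p' q : agree k p p' -> agree k (join p q) (join p' q).
Proof.
  intros H i Hi. unfold join. destruct (Nat.even i); trivial. apply H.
  pose proof (Nat.div2_decr i i (Nat.le_succ_diag_r i)). lia.
Qed.

Lemma Cfb_continuous b o x :
  Cfb b -> exists k, forall o', agree k o o' -> b o' x = b o x.
Proof.
  intro Hb. destruct (Cf_continuous _ o x Hb) as [k Hk]. exists k. intros o' Ho.
  specialize (Hk o' Ho). cbv beta in Hk. now destruct (b o' x), (b o x).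
Qed.

(** For [n] in [A] the sequence [point n 0] is not a name but a limit of names: the first nonzero
    entry can be delayed beyond any [k]. *)
Lemma limit_agree (A : nat -> Prop) n k :
  A n -> exists q, is_name A q n /\ agree k (point n 0) q.
Proof.
  intro HA. exists (fun i => if i =? 0 then n else if i <? k then 0 else 1). split.
  - split; [reflexivity|]. split; trivial. intros _. exists k.
    destruct (Nat.eqb_spec (2 * k + 1) 0); [lia|].
    destruct (Nat.ltb_spec (2 * k + 1) k); lia.
  - intros i Hi. unfold point.
    destruct (Nat.eqb_spec i 0); trivial. destruct (Nat.ltb_spec i k); trivial. lia.
Qed.

(** A positive answer on [point n 0] uses a finite prefix only, hence is also given on a genuine
    name over [n]. *)
Lemma limit_name (A : nat -> Prop) b p n t :
  Cfb b -> A n -> b (join p (point n 0)) t = true ->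
  exists q, is_name A q n /\ b (join p q) t = true.
Proof.
  intros Hb HA Ht. destruct (Cfb_continuous _ (join p (point n 0)) t Hb) as [k Hk].
  destruct (limit_agree A n k HA) as (q & Hq & Hqk). exists q. split; [exact Hq|].
  rewrite <- Ht. now apply Hk, agree_join_r.
Qed.

Definition least (b : nat -> bool) (t : nat) : Prop :=
  b t = true /\ forall k, k < t -> b k = false.

Lemma least_fun b s t : least b s -> least b t -> s = t.
Proof.
  intros [H1 H2] [H3 H4]. destruct (lt_eq_lt_dec s t) as [[H|H]|H]; trivial.
  - rewrite (H4 _ H) in H1. discriminate.
  - rewrite (H2 _ H) in H3. discriminate.
Qed.

Lemma least_exists b : (exists t, b t = true) -> exists t, least b t.
Proof. intros [t Ht]. exact (least_true _ _ Ht). Qed.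

(** Each search sees the results of the earlier ones, which are paired onto the input. *)
Lemma search3_code (b1 b2 b3 : baire -> nat -> nat -> bool) g :
  Cfb (fun o z => b1 o (p1 z) (p2 z)) -> Cfb (fun o z => b2 o (p1 z) (p2 z)) ->
  Cfb (fun o z => b3 o (p1 z) (p2 z)) -> Cf g ->
  exists c, forall o x s t u,
    least (b1 o x) s -> least (b2 o (pr x s)) t -> least (b3 o (pr (pr x s) t)) u ->
    ev o c x (g o (pr (pr (pr x s) t) u)).
Proof.
  intros H1 H2 H3 [cg Hg].
  destruct (search_code _ H1) as [c1 Hc1], (search_code _ H2) as [c2 Hc2],
    (search_code _ H3) as [c3 Hc3].
  exists (Comp cg (Comp (Pair c_id c3) (Comp (Pair c_id c2) (Pair c_id c1)))).
  intros o x s t u [Hs Ls] [Ht Lt] [Hu Lu].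
  eapply ev_comp; [|apply Hg].
  eapply ev_comp; [|apply ev_pair; [apply ev_id | now apply Hc3]].
  eapply ev_comp; [|apply ev_pair; [apply ev_id | now apply Hc2]].
  apply ev_pair; [apply ev_id | now apply Hc1].
Qed.

(** * Normality of [S_ A] for 2-c.e. [A] *)

Section Separation.
Variables (A : nat -> Prop) (b c : nat -> nat -> bool).
Hypothesis Hb : Cfb (fun _ z => b (p1 z) (p2 z)).
Hypothesis Hc : Cfb (fun _ z => c (p1 z) (p2 z)).
Hypothesis HA : forall n, A n <-> (exists t, b n t = true) /\ ~ (exists t, c n t = true).

Definition either (P : baire) (n e t : nat) : bool :=
  accept (evens P) (point n e) t || accept (odds P) (point n e) t.

(** The first search ends by acceptance on [point n 0] or by [b]. In the latter case the second
    determines membership of [n] in [A], recorded as a bit [e], and the third awaits acceptance on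
    [point n e]. In the former case the first disjunct of [stage2] and [stage3] ends both at
    once. *)
Definition stage1 (P : baire) (n t : nat) : bool := either P n 0 t || b n t.

Definition stage2 (P q : baire) (n s t : nat) : bool :=
  either P n 0 s || (negb (q (2 * t + 1) =? 0) || c n t).

Definition stage3 (P : baire) (n s e u : nat) : bool := either P n 0 s || either P n e u.

(** True means that the second open set accepts, also when both do. The point then lies outside the
    second closed set and may go to the first separating set. *)
Definition side (P : baire) (n s e u : nat) : bool :=
  if either P n 0 s then accept (odds P) (point n 0) s else accept (odds P) (point n e) u.

(** [v] says whether the point over [n] goes to the first of the two separating
    sets.  Minimality makes it independent of the name of that point. *)
Definition decision (P : baire) (n : nat) (v : bool) : Prop :=
  exists s e u, (e = 1 /\ A n \/ e = 0 /\ ~ A n) /\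
    least (stage1 P n) s /\ least (stage3 P n s e) u /\ side P n s e u = v.

Lemma decision_fun P n v v' : decision P n v -> decision P n v' -> v = v'.
Proof.
  intros (s & e & u & He & Hs & Hu & <-) (s' & e' & u' & He' & Hs' & Hu' & <-).
  rewrite (least_fun _ _ _ Hs' Hs) in *.
  replace e' with e in * by (destruct He as [[]|[]], He' as [[]|[]]; subst; tauto).
  now rewrite (least_fun _ _ _ Hu' Hu).
Qed.

Lemma Cfb_accept' : Cfb (fun o t => accept (evens o) (odds o) t).
Proof.
  apply (Cfb_accept (fun o _ => evens o) (fun o _ => odds o)); unfold evens, odds; cf.
Qed.

(** The only case in which [point n e] is not a name is [n] in [A] with [e = 0]; there [limit_name]
    moves the acceptance to a name. *)
Lemma accept_point p O n e t :
  codes A p O -> (e = 1 /\ A n \/ e = 0) -> accept p (point n e) t = true -> O n.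
Proof.
  intros Hp He Ht. assert (Hq : exists q, is_name A q n /\ accept p q t = true).
  { destruct (classic (A n)) as [Hn|Hn].
    - destruct He as [[-> _]| ->].
      + exists (point n 1). split; [now apply is_name_top | exact Ht].
      + destruct (limit_name A _ p n t Cfb_accept' Hn) as (q & Hq & Hqt).
        * now rewrite evens_join, odds_join.
        * rewrite evens_join, odds_join in Hqt. now exists q.
    - destruct He as [[_ Hn']| ->]; [easy|]. exists (point n 0).
      split; [now apply is_name_bot | exact Ht]. }
  destruct Hq as (q & Hq & Hqt). apply (accept_spec A p O q n Hp Hq). now exists t.
Qed.

Section Correctness.
Variables (P : baire) (O1 O2 : nat -> Prop).
Hypothesis H1 : codes A (evens P) O1.
Hypothesis H2 : codes A (odds P) O2.
Hypothesis H12 : forall n, O1 n \/ O2 n.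

Lemma decision_sound n v : decision P n v -> if v then O2 n else O1 n.
Proof.
  intros (s & e & u & He & _ & [Hu _] & <-). unfold stage3 in Hu. unfold side.
  assert (He' : e = 1 /\ A n \/ e = 0) by tauto.
  assert (H0 : 0 = 1 /\ A n \/ 0 = 0) by auto.
  destruct (either P n 0 s) eqn:Es.
  - destruct (accept (odds P) (point n 0) s) eqn:Ea.
    + now apply (accept_point (odds P) O2 n 0 s).
    + unfold either in Es. rewrite Ea, Bool.orb_false_r in Es.
      now apply (accept_point (evens P) O1 n 0 s).
  - cbn [orb] in Hu. destruct (accept (odds P) (point n e) u) eqn:Ea.
    + now apply (accept_point (odds P) O2 n e u).
    + unfold either in Hu. rewrite Ea, Bool.orb_false_r in Hu.
      now apply (accept_point (evens P) O1 n e u).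
Qed.

Lemma either_exists n e :
  (e = 1 /\ A n \/ e = 0 /\ ~ A n) -> exists t, either P n e t = true.
Proof.
  intro He. assert (Hq : is_name A (point n e) n).
  { destruct He as [[-> H]|[-> H]]; [now apply is_name_top | now apply is_name_bot]. }
  unfold either. destruct (H12 n) as [H|H].
  - apply (accept_spec A _ _ _ _ H1 Hq) in H. destruct H as [t Ht]. exists t. now rewrite Ht.
  - apply (accept_spec A _ _ _ _ H2 Hq) in H. destruct H as [t Ht]. exists t.
    rewrite Ht. apply Bool.orb_true_r.
Qed.

Lemma decision_search q n : is_name A q n ->
  exists s t u, let e := if q (2 * t + 1) =? 0 then 0 else 1 in
    least (stage1 P n) s /\ least (stage2 P q n s) t /\ least (stage3 P n s e) u /\
    decision P n (side P n s e u).
Proof.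
  intros [Hq0 Hq].
  destruct (least_exists (stage1 P n)) as [s Hs].
  { unfold stage1. destruct (classic (A n)) as [Hn|Hn].
    - apply HA in Hn. destruct Hn as [[t Ht] _]. exists t. rewrite Ht. apply Bool.orb_true_r.
    - destruct (either_exists n 0) as [t Ht]; [tauto|]. exists t. now rewrite Ht. }
  destruct (least_exists (stage2 P q n s)) as [t Ht].
  { unfold stage2. destruct (either P n 0 s) eqn:Es; [now exists 0|]. cbn [orb].
    destruct Hs as [Hs _]. unfold stage1 in Hs. rewrite Es in Hs. cbn [orb] in Hs.
    destruct (classic (A n)) as [Hn|Hn].
    - apply Hq in Hn. destruct Hn as [t Ht]. exists t. apply Nat.eqb_neq in Ht. now rewrite Ht.
    - destruct (classic (exists t, c n t = true)) as [[t Ht]|Hc'].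
      + exists t. rewrite Ht. apply Bool.orb_true_r.
      + exfalso. apply Hn, HA. split; trivial. now exists s. }
  exists s, t. cbv zeta. set (e := if q (2 * t + 1) =? 0 then 0 else 1).
  (* If the first search ended through [b], the bit is right: a nonzero entry shows top, and a zero
     entry means that [c] ended the second search. *)
  assert (He : either P n 0 s = true \/ (e = 1 /\ A n \/ e = 0 /\ ~ A n)).
  { destruct (either P n 0 s) eqn:Es; [now left|]. right.
    destruct Ht as [Ht _]. unfold stage2 in Ht. rewrite Es in Ht. cbn [orb] in Ht. unfold e.
    destruct (Nat.eqb_spec (q (2 * t + 1)) 0) as [H0|H0].
    - cbn in Ht. right. split; trivial. intro Hn. apply HA in Hn. apply Hn. now exists t.
    - left. split; trivial. apply Hq. now exists t. }
  destruct (least_exists (stage3 P n s e)) as [u Hu].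
  { unfold stage3. destruct He as [He|He]; [exists 0; now rewrite He|].
    destruct (either_exists n e He) as [u Hu]. exists u. rewrite Hu. apply Bool.orb_true_r. }
  exists u. repeat split; try apply Hs; try apply Ht; try apply Hu.
  destruct He as [He|He].
  (* After an early acceptance the bit [e] may be wrong, but the result was settled at stage [s];
     [decision] is witnessed by the correct bit instead, with third stage 0. *)
  - pose (e' := if excluded_middle_informative (A n) then 1 else 0).
    exists s, e', 0. split; [|split; [exact Hs | split]].
    + unfold e'. destruct (excluded_middle_informative (A n)); auto.
    + split; [unfold stage3; now rewrite He | intros; lia].
    + unfold side. now rewrite He.
  - now exists s, e, u.
Qed.

End Correctness.

Lemma Cfb_either (P : baire -> nat -> baire) n e t :
  Cf (fun o z => P o (p1 z) (p2 z)) -> Cf n -> Cf e -> Cf t ->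
  Cfb (fun o z => either (P o z) (n o z) (e o z) (t o z)).
Proof.
  intros HP Hn He Ht. unfold either.
  assert (Hz : Cf (fun o z => point (n o (p1 z)) (e o (p1 z)) (p2 z))).
  { unfold point. pose proof (Cf_comp _ _ Hn (Cf_p1 _ Cf_id)).
    pose proof (Cf_comp _ _ He (Cf_p1 _ Cf_id)). cf. }
  apply Cfb_orb.
  - apply (Cfb_accept (fun o z => evens (P o z)) (fun o z => point (n o z) (e o z))); trivial.
    unfold evens. apply (Cf_app2 P); cf.
  - apply (Cfb_accept (fun o z => odds (P o z)) (fun o z => point (n o z) (e o z))); trivial.
    unfold odds. apply (Cf_app2 P); cf.
Qed.

(** Two choices of [f], exchanging 0 and 1, yield the two separating sets from one decision. The
    index and the bit are read off the odd half of the oracle, the name of the point. *)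
Lemma decision_code (f : bool -> nat) : exists d, forall P O1 O2 q n,
  codes A (evens P) O1 -> codes A (odds P) O2 -> (forall n, O1 n \/ O2 n) ->
  is_name A q n ->
  exists v, decision P n v /\ forall j, ev (join P q) d j (f v).
Proof.
  pose (n := fun o : baire => odds o 0).
  pose (bit := fun (o : baire) t => if odds o (2 * t + 1) =? 0 then 0 else 1).
  assert (Hn : Cf (fun o z => n o)) by (unfold n, odds; cf).
  assert (Hbit : forall g, Cf g -> Cf (fun o z => bit o (g o z))).
  { intros g Hg. unfold bit, odds. cf. }
  assert (HE : forall e t, Cf e -> Cf t ->
    Cfb (fun o z => either (evens o) (n o) (e o z) (t o z))).
  { intros e t He Ht. apply (Cfb_either (fun o _ => evens o) (fun o _ => n o)); trivial.
    unfold evens. cf. }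
  assert (HbC : forall t, Cf t -> Cfb (fun o z => b (n o) (t o z))).
  { intros t Ht. exact (Cf_app2 (fun _ u v => if b u v then 1 else 0) _ _ Hb Hn Ht). }
  assert (HcC : forall t, Cf t -> Cfb (fun o z => c (n o) (t o z))).
  { intros t Ht. exact (Cf_app2 (fun _ u v => if c u v then 1 else 0) _ _ Hc Hn Ht). }
  destruct (search3_code
    (fun o _ t => stage1 (evens o) (n o) t)
    (fun o x t => stage2 (evens o) (odds o) (n o) (p2 x) t)
    (fun o x t => stage3 (evens o) (n o) (p2 (p1 x)) (bit o (p2 x)) t)
    (fun o x => if side (evens o) (n o) (p2 (p1 (p1 x))) (bit o (p2 (p1 x))) (p2 x)
                then f true else f false)) as [d Hd].
  - unfold stage1. apply Cfb_orb; [apply HE | apply HbC]; cf.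
  - unfold stage2. apply Cfb_orb; [apply HE; cf|]. apply Cfb_orb; [|apply HcC; cf].
    unfold odds. cf.
  - unfold stage3. apply Cfb_orb; apply HE; first [apply Hbit; cf | cf].
  - apply Cf_if; [|cf|cf].
    assert (Ha : forall e t, Cf e -> Cf t ->
      Cfb (fun o z => accept (odds (evens o)) (point (n o) (e o z)) (t o z))).
    { intros e t He Ht. apply (Cfb_accept (fun o _ => odds (evens o))
        (fun o z => point (n o) (e o z))); trivial.
      - unfold odds, evens. cf.
      - unfold point. pose proof (Cf_comp _ _ He (Cf_p1 _ Cf_id)). cf. }
    unfold side. apply Cfb_if.
    + apply HE; cf.
    + apply Ha; cf.
    + apply Ha; [apply Hbit|]; cf.
  - exists d. intros P O1 O2 q m H1 H2 H12 Hq.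
    destruct (decision_search P O1 O2 H1 H2 H12 q m Hq) as (s & t & u & Hs & Ht & Hu & HD).
    exists (side P m s (if q (2 * t + 1) =? 0 then 0 else 1) u). split; [exact HD|].
    intro j. specialize (Hd (join P q) j s t u). unfold n, bit in Hd.
    rewrite ?evens_join, ?odds_join, ?p1_pr, ?p2_pr, (proj1 Hq) in Hd.
    rewrite ?p1_pr, ?p2_pr in Hd. specialize (Hd Hs Ht Hu). rewrite ?p1_pr, ?p2_pr in Hd.
    destruct (side P m s _ u); exact Hd.
Qed.

Lemma normal_of_stages : computably_normal (S_ A).
Proof.
  destruct (decision_code (fun v => if v then 1 else 0)) as [d Hd].
  destruct (decision_code (fun v => if v then 0 else 1)) as [d' Hd'].
  (* A name of an open set: the index of the program [d], followed by [P] itself as its oracle. *)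
  pose (name := fun (d : code) (P : baire) m => if m =? 0 then encode d else P (Nat.pred m)).
  apply (normal_of_functional A (fun P => join (name d P) (name d' P))).
  - apply (Cf_join (fun P _ => name d P) (fun P _ => name d' P) (fun _ m => m));
      unfold name; cf.
  - intros P O1 O2 H1 H2 H12.
    exists (fun n => decision P n true), (fun n => decision P n false).
    rewrite evens_join, odds_join. split; [|split; [|split; [|split]]].
    + intros q n Hq. destruct (Hd P O1 O2 q n H1 H2 H12 Hq) as (v & Hv & Hj).
      exists (fun _ => if v then 1 else 0). split; [now exists d|]. destruct v; split; trivial.
      * intros _. now exists 0.
      * now intros [_ []].
      * intro H. discriminate (decision_fun _ _ _ _ Hv H).
    + intros q n Hq. destruct (Hd' P O1 O2 q n H1 H2 H12 Hq) as (v & Hv & Hj).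
      exists (fun _ => if v then 0 else 1). split; [now exists d'|]. destruct v; split; trivial.
      * now intros [_ []].
      * intro H. discriminate (decision_fun _ _ _ _ Hv H).
      * intros _. now exists 0.
    + intros n [H H']. discriminate (decision_fun _ _ _ _ H H').
    + intro n. destruct (classic (A n)) as [Hn|Hn].
      * destruct (Hd P O1 O2 _ n H1 H2 H12 (is_name_top A n Hn)) as ([] & Hv & _); [now left|].
        right. exact (decision_sound P O1 O2 H1 H2 n false Hv).
      * destruct (Hd P O1 O2 _ n H1 H2 H12 (is_name_bot A n Hn)) as ([] & Hv & _); [now left|].
        right. exact (decision_sound P O1 O2 H1 H2 n false Hv).
    + intro n. destruct (classic (A n)) as [Hn|Hn].
      * destruct (Hd P O1 O2 _ n H1 H2 H12 (is_name_top A n Hn)) as ([] & Hv & _); [|now left].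
        right. exact (decision_sound P O1 O2 H1 H2 n true Hv).
      * destruct (Hd P O1 O2 _ n H1 H2 H12 (is_name_bot A n Hn)) as ([] & Hv & _); [|now left].
        right. exact (decision_sound P O1 O2 H1 H2 n true Hv).
Qed.

End Separation.

Lemma two_ce_normal A : two_ce A -> computably_normal (S_ A).
Proof.
  intros (B & C & HB & HC & HA).
  apply ce_stage in HB. destruct HB as (b & Hb & HB).
  apply ce_stage in HC. destruct HC as (c & Hc & HC).
  apply (normal_of_stages A b c Hb Hc). intro n. now rewrite HA, HB, HC.
Qed.

(** * Normality implies 2-c.e. *)

(** The normality operator is given by a partial program. Its output is fed into the acceptance
    search by [rel], and halting of the composite is then replaced by stage predicates [u] and [v]
    that are total on all oracles. *)
Lemma norm_stages A :
  computably_normal (S_ A) ->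
  exists u v, Cfb u /\ Cfb v /\ forall P O1 O2,
    codes A (evens P) O1 -> codes A (odds P) O2 -> (forall n, O1 n \/ O2 n) ->
    exists U V : nat -> Prop,
      (forall n, ~ (U n /\ V n)) /\ (forall n, U n \/ O1 n) /\ (forall n, V n \/ O2 n) /\
      forall q n, is_name A q n ->
        (U n <-> exists t, u (join P q) t = true) /\ (V n <-> exists t, v (join P q) t = true).
Proof.
  intro HN. destruct (norm_code A HN) as [c Hc].
  destruct (stage_halting (fun o _ t => accept (evens o) (odds o) t)) as [a Ha].
  { apply (Cfb_accept (fun o _ => evens o) (fun o _ => odds o)); unfold evens, odds; cf. }
  (* [i] is 0 or 1 and selects the even or odd half of [Q], the name of the first or second
     separating set. *)
  assert (HW : forall i, exists b, Cfb b /\ forall P q Q,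
    (forall m, ev P c m (Q m)) ->
    ((exists t, b (join P q) t = true) <->
     exists t, accept (fun m => Q (2 * m + i)) q t = true)).
  { intro i.
    assert (HE : Cf (fun o z => o (2 * p2 z))) by cf. destruct HE as [dE HE].
    assert (HI : Cf (fun _ z => pr 0 (2 * Nat.div2 (p2 z) + i))) by cf. destruct HI as [dI HI].
    assert (HH : Cf (fun o z => if Nat.even (p2 (p1 z)) then p2 z else o (p2 (p1 z)))) by cf.
    destruct HH as [dH HH].
    (* Answers questions to the join of the selected half of [Q] with [q]. At odd places [join P q]
       already has the entries of [q], so [dH] asks the given oracle there. *)
    pose (d := Comp dH (Pair c_id (Comp (rel dE c) dI))).
    assert (Hd : forall P q Q, (forall m, ev P c m (Q m)) ->
      forall m, ev (join P q) d (pr 0 m) (join (fun m => Q (2 * m + i)) q m)).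
    { intros P q Q HQ m. eapply ev_comp.
      - apply ev_pair; [apply ev_id|]. eapply ev_comp; [apply HI|].
        apply (ev_rel (join P q) dE P 0); [|apply HQ].
        intro k. pose proof (HE (join P q) (pr 0 k)) as H. rewrite p2_pr in H.
        change (join P q (2 * k)) with (evens (join P q) k) in H. now rewrite evens_join in H.
      - pose proof (HH (join P q) (pr (pr 0 m) (Q (2 * Nat.div2 m + i)))) as H.
        autorewrite with pair in H |- *.
        unfold join at 2. unfold join at 2 in H. destruct (Nat.even m); exact H. }
    destruct (halting_stage (rel d a)) as (b & Hb & Hbs).
    exists (fun o t => b o (pr 0 0) t). split.
    - apply (Cf_app2 (fun o x t => if b o x t then 1 else 0)); trivial; cf.
    - intros P q Q HQ. rewrite <- Hbs.
      pose proof (Ha (join (fun m => Q (2 * m + i)) q) 0) as HaQ.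
      cbv beta in HaQ. rewrite evens_join, odds_join in HaQ. rewrite <- HaQ.
      split; intros [y Hy]; exists y; now apply (ev_rel_total _ _ _ _ _ _ _ (Hd P q Q HQ)). }
  destruct (HW 0) as (u & Hu & HuS), (HW 1) as (v & Hv & HvS).
  exists u, v. split; [exact Hu | split; [exact Hv|]]. intros P O1 O2 H1 H2 H12.
  destruct (Hc P O1 O2 H1 H2 H12) as (Q & U & V & HQ & HU & HV & HD & HUO & HVO).
  exists U, V. do 3 (split; [assumption|]). intros q n Hq. split.
  - rewrite (HuS P q Q HQ). rewrite (accept_spec A _ _ _ _ HU Hq).
    replace (fun m => Q (2 * m + 0)) with (evens Q); [reflexivity|].
    apply functional_extensionality. intro m. unfold evens. now rewrite Nat.add_0_r.
  - rewrite (HvS P q Q HQ). rewrite (accept_spec A _ _ _ _ HV Hq). reflexivity.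
Qed.

Lemma normal_two_ce A : computably_normal (S_ A) -> two_ce A.
Proof.
  intro HN. destruct (norm_stages A HN) as (u & v & Hu & Hv & Huv).
  (* Realisers of the two open sets. Points with another index are accepted; over [n], the first
     copies the Sierpinski part of the name and the second the flags in its own oracle. *)
  assert (Hf1 : Cf (fun o j => if odds o 0 =? evens o 0 then odds o (2 * j + 1) else 1)).
  { unfold odds, evens. cf. }
  assert (Hf2 : Cf (fun o j => if odds o 0 =? evens o 0 then evens o (S j) else 1)).
  { unfold odds, evens. cf. }
  destruct Hf1 as [c1 Hc1], Hf2 as [c2 Hc2].
  pose (name1 := fun n m => if m =? 0 then encode c1 else n).
  (* The oracle part holds [n] at place 0 and a flag at place [k]. For [k = 0] the entry [n] takes
     precedence and no flag appears, so 0 stands for never adding [n]. *)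
  pose (name2 := fun n k m =>
    if m =? 0 then encode c2 else if Nat.pred m =? 0 then n else if Nat.pred m =? k then 1 else 0).
  pose (P := fun n k => join (name1 n) (name2 n k)).
  assert (HO1 : forall n k, codes A (evens (P n k)) (fun m => m <> n \/ A m)).
  { intros n k q m [Hq0 Hq]. unfold P. rewrite evens_join. eexists. split.
    - exists c1. split; [reflexivity|]. intro j. apply Hc1.
    - cbv beta. rewrite evens_join, odds_join, Hq0. cbn.
      destruct (Nat.eqb_spec m n) as [->|Hne].
      + rewrite <- Hq. tauto.
      + split; [now left | intros _; now exists 0]. }
  assert (HO2 : forall n k, codes A (odds (P n k)) (fun m => m <> n \/ k <> 0)).
  { intros n k q m [Hq0 Hq]. unfold P. rewrite odds_join. eexists. split.
    - exists c2. split; [reflexivity|]. intro j. apply Hc2.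
    - cbv beta. rewrite evens_join, odds_join, Hq0. cbn.
      destruct (Nat.eqb_spec m n) as [->|Hne].
      + split.
        * intros [j Hj]. right. intros ->. now apply Hj.
        * intros [H|H]; [easy|]. destruct k as [|k]; [easy|]. exists k.
          now rewrite Nat.eqb_refl.
      + split; [now left | intros _; now exists 0]. }
  assert (Hcov : forall n k, A n \/ k <> 0 ->
    forall m, (m <> n \/ A m) \/ (m <> n \/ k <> 0)).
  { intros n k H m. destruct (Nat.eq_dec m n) as [->|]; tauto. }
  assert (HPc : Cf (fun o z => join (P (p1 (p1 z)) (p1 (p2 (p1 z))))
      (point (p1 (p1 z)) (p2 (p2 (p1 z)))) (p2 z))).
  { apply (Cf_join (fun o z => P (p1 (p1 z)) (p1 (p2 (p1 z))))
                   (fun o z => point (p1 (p1 z)) (p2 (p2 (p1 z))))).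
    - unfold P. apply (Cf_join (fun o z => name1 (p1 (p1 (p1 z))))
        (fun o z => name2 (p1 (p1 (p1 z))) (p1 (p2 (p1 (p1 z)))))); unfold name1, name2; cf.
    - unfold point. cf.
    - cf. }
  assert (Hsub : forall b n k e t, Cfb b -> Cf n -> Cf k -> Cf e -> Cf t ->
    Cfb (fun o z => b (join (P (n o z) (k o z)) (point (n o z) (e o z))) (t o z))).
  { intros b n k e t Hb Hn Hk He Ht.
    assert (Hg : Cf (fun o z => pr (n o z) (pr (k o z) (e o z)))) by cf.
    pose proof (Cf_subst _ (fun o z => join (P (p1 z) (p1 (p2 z))) (point (p1 z) (p2 (p2 z))))
      _ _ Hb HPc Hg Ht) as H.
    refine (Cf_ext _ _ H _). intros o x. cbv beta. autorewrite with pair. reflexivity. }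
  exists (fun n => exists t, v (join (P n 0) (point n 1)) t = true),
    (* [w] codes a place and two stages; the successor excludes the place 0. *)
    (fun n => exists w, (v (join (P n (S (p1 w))) (point n 1)) (p1 (p2 w)) &&
                         u (join (P n (S (p1 w))) (point n 0)) (p2 (p2 w)))%bool = true).
  split; [|split].
  - apply ce_stage. exists (fun n => v (join (P n 0) (point n 1))).
    split; [|intro n; reflexivity].
    apply (Hsub v (fun _ z => p1 z) (fun _ _ => 0) (fun _ _ => 1) (fun _ z => p2 z)); trivial; cf.
  - apply ce_stage.
    exists (fun n w => v (join (P n (S (p1 w))) (point n 1)) (p1 (p2 w)) &&
                       u (join (P n (S (p1 w))) (point n 0)) (p2 (p2 w)))%bool.
    split; [|intro n; reflexivity].
    apply Cfb_andb.
    + apply (Hsub v (fun _ z => p1 z) (fun _ z => S (p1 (p2 z))) (fun _ _ => 1)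
        (fun _ z => p1 (p2 (p2 z)))); trivial; cf.
    + apply (Hsub u (fun _ z => p1 z) (fun _ z => S (p1 (p2 z))) (fun _ _ => 0)
        (fun _ z => p2 (p2 (p2 z)))); trivial; cf.
  - intro n. split.
    + intro Hn. split.
      (* With [k = 0] the second open set omits [n], so [V] has to contain [n]. *)
      * destruct (Huv (P n 0) _ _ (HO1 n 0) (HO2 n 0) (Hcov n 0 (or_introl Hn)))
          as (U & V & HD & HU & HV & Hacc).
        apply (Hacc (point n 1) n (is_name_top A n Hn)).
        destruct (HV n) as [H|[H|H]]; easy.
      * intros [w Hw]. apply andb_prop in Hw. destruct Hw as [Hw1 Hw0].
        destruct (Huv (P n (S (p1 w))) _ _ (HO1 n _) (HO2 n _) (Hcov n _ (or_introl Hn)))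
          as (U & V & HD & HU & HV & Hacc).
        apply (HD n). split.
        (* Acceptance by [u] on the limit [point n 0] passes to a name over [n], which puts [n] into
           [U] as well as [V]. *)
        -- destruct (limit_name A u _ n _ Hu Hn Hw0) as (q & Hq & Hqt).
           apply (Hacc q n Hq). now exists (p2 (p2 w)).
        -- apply (Hacc _ n (is_name_top A n Hn)). now exists (p1 (p2 w)).
    + intros [[t Ht] HC]. apply NNPP. intro Hn. apply HC.
      (* The acceptance by [v] reads fewer than [k] places, so it persists when [n] is added at
         place [S k]. The cover condition now holds although [n] is outside [A], and [U] must accept
         [n]. *)
      destruct (Cfb_continuous v (join (P n 0) (point n 1)) t Hv) as [k Hk].
      assert (Hk0 : S k <> 0) by lia.
      destruct (Huv (P n (S k)) _ _ (HO1 n _) (HO2 n _) (Hcov n _ (or_intror Hk0)))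
        as (U & V & HD & HU & HV & Hacc).
      assert (HUn : U n) by (destruct (HU n) as [H|[H|H]]; easy).
      apply (Hacc _ n (is_name_bot A n Hn)) in HUn. destruct HUn as [t' Ht'].
      exists (pr k (pr t t')). autorewrite with pair. rewrite Ht', Bool.andb_true_r.
      rewrite <- Ht. apply Hk, agree_join_l. unfold P. apply agree_join_r.
      intros i Hi. unfold name2. destruct (Nat.eqb_spec i 0); trivial.
      destruct (Nat.eqb_spec (Nat.pred i) 0); trivial.
      destruct (Nat.eqb_spec (Nat.pred i) (S k)); [lia | reflexivity].
Qed.

(** * Rational approximations *)

Lemma rational_p m :
  rational m = ((INR (p1 (p1 m)) - INR (p2 (p1 m))) / INR (S (p2 m)))%R.
Proof.
  unfold rational, p1, p2. destruct (of_nat m) as [d c]. cbn [fst snd].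
  now destruct (of_nat d).
Qed.

(** Cleared of denominators and negative terms, so that the comparison runs on natural numbers. It
    witnesses that approximations [a] and [b], of precisions [j] and [k], belong to different
    reals. *)
Definition gap (a j b k : nat) : bool :=
  (p2 (p1 a) * S (p2 b) + p1 (p1 b) * S (p2 a)) * (2 ^ j * 2 ^ k) +
    S (p2 a) * S (p2 b) * (2 ^ j + 2 ^ k) <?
  (p1 (p1 a) * S (p2 b) + p2 (p1 b) * S (p2 a)) * (2 ^ j * 2 ^ k).

Lemma gap_spec a j b k :
  gap a j b k = true <-> (rational b + / 2 ^ j + / 2 ^ k < rational a)%R.
Proof.
  unfold gap. rewrite Nat.ltb_lt, !rational_p.
  generalize (p1 (p1 a)) as a1, (p2 (p1 a)) as a2, (p2 a) as a3,
             (p1 (p1 b)) as b1, (p2 (p1 b)) as b2, (p2 b) as b3.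
  intros a1 a2 a3 b1 b2 b3.
  assert (HI : forall u v, u < v <-> (INR u < INR v)%R).
  { intros u v. split; [apply lt_INR | apply INR_lt]. }
  rewrite HI. repeat rewrite ?plus_INR, ?mult_INR, ?pow_INR.
  change (INR 2) with 2%R.
  pose proof (lt_0_INR (S a3) (Nat.lt_0_succ _)) as Ha.
  pose proof (lt_0_INR (S b3) (Nat.lt_0_succ _)) as Hb.
  assert (Hj : (0 < 2 ^ j)%R) by (apply pow_lt; lra).
  assert (Hk : (0 < 2 ^ k)%R) by (apply pow_lt; lra).
  revert Ha Hb Hj Hk.
  generalize (INR a1) as x1, (INR a2) as x2, (INR (S a3)) as x3,
             (INR b1) as y1, (INR b2) as y2, (INR (S b3)) as y3,
             (2 ^ j)%R as J, (2 ^ k)%R as K.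
  intros x1 x2 x3 y1 y2 y3 J K Ha Hb Hj Hk.
  assert (HD : (0 < x3 * y3 * (J * K))%R) by (repeat apply Rmult_lt_0_compat; trivial).
  split; intro H.
  - apply Rmult_lt_reg_r with (1 := HD).
    replace (((y1 - y2) / y3 + / J + / K) * (x3 * y3 * (J * K)))%R with
      (((x2 * y3 + y1 * x3) * (J * K) + x3 * y3 * (J + K))
       - (x2 * y3 + y2 * x3) * (J * K))%R by (field; lra).
    replace ((x1 - x2) / x3 * (x3 * y3 * (J * K)))%R with
      ((x1 * y3 + y2 * x3) * (J * K) - (x2 * y3 + y2 * x3) * (J * K))%R by (field; lra).
    lra.
  - apply Rmult_lt_compat_r with (1 := HD) in H.
    replace (((y1 - y2) / y3 + / J + / K) * (x3 * y3 * (J * K)))%R with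
      (((x2 * y3 + y1 * x3) * (J * K) + x3 * y3 * (J + K))
       - (x2 * y3 + y2 * x3) * (J * K))%R in H by (field; lra).
    replace ((x1 - x2) / x3 * (x3 * y3 * (J * K)))%R with
      ((x1 * y3 + y2 * x3) * (J * K) - (x2 * y3 + y2 * x3) * (J * K))%R in H by (field; lra).
    lra.
Qed.

Lemma Cfb_gap a j b k :
  Cf a -> Cf j -> Cf b -> Cf k -> Cfb (fun o z => gap (a o z) (j o z) (b o z) (k o z)).
Proof. intros Ha Hj Hb Hk. unfold gap. cf. Qed.

Definition zero_code : nat := pr (pr 0 0) 0.
Definition pow_code (s : nat) : nat := pr (pr 1 0) (2 ^ s - 1).

Lemma rational_zero : rational zero_code = 0%R.
Proof. rewrite rational_p. unfold zero_code. autorewrite with pair. cbn. lra. Qed.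

Lemma rational_pow s : rational (pow_code s) = (/ 2 ^ s)%R.
Proof.
  rewrite rational_p. unfold pow_code. autorewrite with pair.
  assert (H0 : 2 ^ s <> 0) by (apply Nat.pow_nonzero; lia).
  replace (S (2 ^ s - 1)) with (2 ^ s) by lia. rewrite pow_INR.
  change (INR 2) with 2%R. change (INR 1) with 1%R. change (INR 0) with 0%R.
  unfold Rdiv. lra.
Qed.

Lemma inv_pow2_pos n : (0 < / 2 ^ n)%R.
Proof. apply Rinv_0_lt_compat, pow_lt. lra. Qed.

Lemma inv_pow2_le m n : m <= n -> (/ 2 ^ n <= / 2 ^ m)%R.
Proof.
  intro H. apply Rinv_le_contravar; [apply pow_lt; lra|]. apply Rle_pow; [lra | exact H].
Qed.

(** * The embedding into the Hilbert cube for 2-c.e. sets *)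

Definition cube_name (y : nat -> R) (p : baire) : Prop :=
  forall i j, (Rabs (rational (p (pr i j)) - y i) <= / 2 ^ j)%R.

Definition code_map (c : code) : pmap :=
  {| pgraph := fun p q => forall n, ev p c n (q n);
     pgraph_fun := fun p q r Hq Hr =>
       functional_extensionality q r (fun n => ev_fun (Hq n) (Hr n)) |}.

Lemma code_map_computable c : pmap_computable (code_map c).
Proof. exists c. intros p q H. exact H. Qed.

Section Embedding.
Variables (A : nat -> Prop) (b c : nat -> nat -> bool).
Hypothesis Hb : Cfb (fun _ z => b (p1 z) (p2 z)).
Hypothesis Hc : Cfb (fun _ z => c (p1 z) (p2 z)).
Hypothesis HA : forall n, A n <-> (exists t, b n t = true) /\ ~ (exists t, c n t = true).

(** A bounded search, hence total: the counter stops at the first stage where [b] holds, and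
    [b n (first n j)] tells whether there is one up to [j]. *)
Definition first (n j : nat) : nat := Nat.iter j (fun r => if b n r then r else S r) 0.

Lemma first_least n s j : least (b n) s -> first n j = Nat.min j s.
Proof.
  intros [Hs Hl]. unfold first. induction j as [|j IH]; [reflexivity|].
  rewrite Nat.iter_succ, IH. destruct (Nat.le_gt_cases s j) as [H|H].
  - rewrite Nat.min_r, Hs by lia. lia.
  - rewrite Nat.min_l, Hl by lia. lia.
Qed.

(** [(/ 2 ^ s, 0, ..., 0, 1, 0, ...)], the [1] at place [n + 1], where [s] is
    the stage at which [n] is enumerated by [b]; for [n] outside [A] the first
    coordinate is [0]. *)
Definition image (n : nat) (y : nat -> R) : Prop :=
  (forall k, y (S k) = if k =? n then 1%R else 0%R) /\
  (~ A n -> y 0 = 0%R) /\ (A n -> exists s, least (b n) s /\ y 0 = (/ 2 ^ s)%R).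

Lemma image_exists n : exists y, image n y.
Proof.
  destruct (classic (A n)) as [Hn|Hn].
  - destruct (least_exists (b n)) as [s Hs]; [now apply HA|].
    exists (fun i => if i =? 0 then (/ 2 ^ s)%R else if Nat.pred i =? n then 1%R else 0%R).
    split; [reflexivity | split; [easy|]]. intros _. now exists s.
  - exists (fun i => if i =? 0 then 0%R else if Nat.pred i =? n then 1%R else 0%R).
    split; [reflexivity | split; easy].
Qed.

Lemma image_bounds n y : image n y -> forall i, (0 <= y i <= 1)%R.
Proof.
  intros (H1 & H0 & Hs) [|i].
  - destruct (classic (A n)) as [Hn|Hn].
    + destruct (Hs Hn) as (s & _ & ->). pose proof (inv_pow2_pos s).
      pose proof (inv_pow2_le 0 s (Nat.le_0_l s)) as H'. cbn in H'. lra.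
    + rewrite (H0 Hn). lra.
  - rewrite H1. destruct (i =? n); lra.
Qed.

(** At precision [j] only the stages of [b] up to [j] matter: if [n] is enumerated later, the first
    coordinate is at most 2^-j and 0 is a valid output. Once [n] has been enumerated, waiting for
    top or for [c] settles the coordinate exactly. *)
Lemma embed_code : exists d, forall q n y, is_name A q n -> image n y ->
  exists p, (forall m, ev q d m (p m)) /\ cube_name y p.
Proof.
  assert (Hfirst : forall f g, Cf f -> Cf g -> Cf (fun o z => first (f o z) (g o z))).
  { intros f g Hf Hg. unfold first.
    apply (Cf_iter g (fun o z r => if b (f o z) r then r else S r)); [|cf..].
    apply Cf_if; [|cf..].
    apply (Cf_app2 (fun _ u v => if b u v then 1 else 0)); trivial; [|cf].
    exact (Cf_comp _ _ Hf (Cf_p1 _ Cf_id)). }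
  assert (HbC : forall f g, Cf f -> Cf g -> Cfb (fun o z => b (f o z) (g o z))).
  { intros f g Hf Hg. exact (Cf_app2 (fun _ u v => if b u v then 1 else 0) _ _ Hb Hf Hg). }
  assert (HcC : forall f g, Cf f -> Cf g -> Cfb (fun o z => c (f o z) (g o z))).
  { intros f g Hf Hg. exact (Cf_app2 (fun _ u v => if c u v then 1 else 0) _ _ Hc Hf Hg). }
  pose (found := fun n m => b n (first n (p2 m))).
  pose (ready := fun (q : baire) m w =>
    (negb (p1 m =? 0) || (negb (found (q 0) m) || (negb (q (2 * w + 1) =? 0) || c (q 0) w)))%bool).
  pose (out := fun (q : baire) m w =>
    if p1 m =? 0 then
      if (found (q 0) m && negb (q (2 * w + 1) =? 0))%bool then pow_code (first (q 0) (p2 m))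
      else zero_code
    else if Nat.pred (p1 m) =? q 0 then pow_code 0 else zero_code).
  assert (Hfound : forall f, Cf f -> Cfb (fun o z => found (o 0) (f o z))).
  { intros f Hf. unfold found. apply HbC; [cf|]. apply Hfirst; cf. }
  destruct (search_code ready) as [c1 Hc1].
  { unfold ready. repeat apply Cfb_orb; try apply HcC; cf. apply Hfound. cf. }
  assert (Hout : Cf (fun o z => out o (p1 z) (p2 z))).
  { unfold out, pow_code, zero_code. apply Cf_if; [cf | apply Cf_if | cf]; [|cf|cf].
    - apply Cfb_andb; [apply Hfound|]; cf.
    - apply Hfirst; cf. }
  destruct Hout as [c2 Hc2].
  exists (Comp c2 (Pair c_id c1)). intros q n y [Hq0 Hq] (Hy1 & Hy0 & Hys).
  assert (Hm : forall m, exists v, ev q (Comp c2 (Pair c_id c1)) m v /\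
    (Rabs (rational v - y (p1 m)) <= / 2 ^ (p2 m))%R).
  { intro m. destruct (least_exists (ready q m)) as [w [Hw Hl]].
    { unfold ready. rewrite Hq0. destruct (p1 m =? 0); [|now exists 0]. cbn [negb orb].
      destruct (found n m) eqn:Ef; [|now exists 0]. cbn [negb orb].
      destruct (classic (A n)) as [Hn|Hn].
      - apply Hq in Hn. destruct Hn as [w Hw]. exists w. apply Nat.eqb_neq in Hw. now rewrite Hw.
      - destruct (classic (exists t, c n t = true)) as [[w Hw]|Hc'].
        + exists w. rewrite Hw. apply Bool.orb_true_r.
        + exfalso. apply Hn, HA. split; trivial. now exists (first n (p2 m)). }
    exists (out q m w). split.
    { eapply ev_comp; [apply ev_pair; [apply ev_id | exact (Hc1 q m w Hw Hl)]|].
      pose proof (Hc2 q (pr m w)) as H. now autorewrite with pair in H. }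
    assert (Hexact : forall x z, x = z -> (Rabs (x - z) <= / 2 ^ p2 m)%R).
    { intros x z ->. replace (z - z)%R with 0%R by lra. rewrite Rabs_R0.
      apply Rlt_le, inv_pow2_pos. }
    unfold ready in Hw. unfold out. rewrite Hq0 in Hw |- *.
    destruct (Nat.eqb_spec (p1 m) 0) as [Hm0|Hm0].
    - rewrite Hm0. cbn [negb orb] in Hw. destruct (found n m) eqn:Ef; cbn [negb orb andb] in *.
      + destruct (Nat.eqb_spec (q (2 * w + 1)) 0) as [Hz|Hz]; cbn [negb orb] in *.
        * apply Hexact. rewrite rational_zero, Hy0; trivial.
          intro Hn. apply HA in Hn. apply Hn. now exists w.
        * apply Hexact. rewrite rational_pow.
          destruct Hys as (s & Hs & ->); [apply Hq; now exists w|].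
          unfold found in Ef. rewrite (first_least n s _ Hs) in Ef |- *.
          destruct (Nat.le_gt_cases s (p2 m)) as [H|H]; [now rewrite Nat.min_r|].
          rewrite Nat.min_l in Ef by lia. now rewrite (proj2 Hs) in Ef.
      + rewrite rational_zero. destruct (classic (A n)) as [Hn|Hn].
        * destruct (Hys Hn) as (s & Hs & ->). unfold found in Ef.
          rewrite (first_least n s _ Hs) in Ef.
          destruct (Nat.le_gt_cases s (p2 m)) as [H|H].
          -- rewrite Nat.min_r in Ef by exact H. rewrite (proj1 Hs) in Ef. discriminate.
          -- rewrite Rminus_0_l, Rabs_Ropp, Rabs_right;
               [apply inv_pow2_le; lia | apply Rle_ge, Rlt_le, inv_pow2_pos].
        * apply Hexact. now rewrite Hy0.
    - apply Hexact. destruct (p1 m) as [|k]; [easy|]. cbn [Nat.pred]. rewrite Hy1.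
      destruct (k =? n); [|apply rational_zero]. rewrite rational_pow. cbn. lra. }
  destruct (baire_choice Hm) as [p Hp]. exists p. split; [apply Hp|].
  intros i j. destruct (Hp (pr i j)) as [_ H]. now autorewrite with pair in H.
Qed.

Lemma inverse_code : exists d, forall n y p, image n y -> cube_name y p ->
  exists q, (forall m, ev p d m (q m)) /\ is_name A q n.
Proof.
  (* Precision 1/4 separates the values 0 and 1: the approximation exceeds 1/2 exactly at the
     coordinate that carries the index. *)
  pose (ind := fun (p : baire) (m k : nat) => gap (p (pr (S k) 2)) 2 zero_code 2).
  destruct (search_code ind) as [c1 Hc1].
  { unfold ind, zero_code. apply Cfb_gap; cf. }
  assert (Hout : Cf (fun p z => if Nat.even (p1 z) then p2 z else
    if gap (p (pr 0 (Nat.div2 (p1 z)))) (Nat.div2 (p1 z)) zero_code (Nat.div2 (p1 z))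
    then 1 else 0)).
  { unfold zero_code. apply Cf_if; [cf|cf|]. apply Cf_if; [|cf|cf]. apply Cfb_gap; cf. }
  destruct Hout as [c2 Hc2].
  exists (Comp c2 (Pair c_id c1)). intros n y p (Hy1 & Hy0 & Hys) Hp.
  assert (Hind : forall m, least (ind p m) n).
  { intro m. assert (H : forall k, ind p m k = true <-> k = n).
    { intro k. unfold ind. rewrite gap_spec, rational_zero.
      pose proof (Hp (S k) 2) as H. rewrite Hy1 in H. cbn [pow] in *.
      revert H. destruct (Nat.eqb_spec k n) as [Hk|Hk]; intro H.
      - split; [easy|]. intros _. revert H. unfold Rabs. destruct Rcase_abs; lra.
      - split; [|easy]. revert H. unfold Rabs. destruct Rcase_abs; lra. }
    split; [now apply H|]. intros k Hk. destruct (ind p m k) eqn:E; trivial.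
    apply H in E. lia. }
  exists (fun m => if Nat.even m then n else
    if gap (p (pr 0 (Nat.div2 m))) (Nat.div2 m) zero_code (Nat.div2 m) then 1 else 0).
  split; [|split; [reflexivity|]].
  - intro m. eapply ev_comp; [apply ev_pair; [apply ev_id | apply (Hc1 p m n); apply Hind]|].
    pose proof (Hc2 p (pr m n)) as H. now autorewrite with pair in H.
  - assert (Hodd : forall j, (if Nat.even (2 * j + 1) then n else
        if gap (p (pr 0 (Nat.div2 (2 * j + 1)))) (Nat.div2 (2 * j + 1)) zero_code
             (Nat.div2 (2 * j + 1)) then 1 else 0) <> 0 <->
      (/ 2 ^ j + / 2 ^ j < rational (p (pr 0 j)))%R).
    { intro j. rewrite Nat.even_odd. rewrite Nat.add_1_r, Nat.div2_succ_double.
      destruct (gap _ _ _ _) eqn:E.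
      - apply gap_spec in E. rewrite rational_zero in E. split; [lra | easy].
      - split; [easy|]. intros H _. enough (false = true) by discriminate.
        rewrite <- E. apply gap_spec. rewrite rational_zero. lra. }
    split.
    + intro Hn. destruct (Hys Hn) as (s & _ & Hs). pose proof (inv_pow2_pos s) as Hpos.
      (* With 2^-j below a third of 2^-s, any approximation, being at least 2^-s - 2^-j, exceeds the
         threshold 2^-j + 2^-j. *)
      destruct (pow2_inv_small (e := (/ 2 ^ s / 3)%R)) as [j Hj]; [lra|].
      exists j. apply Hodd. pose proof (Hp 0 j) as H. rewrite Hs in H. revert H.
      unfold Rabs. destruct Rcase_abs; lra.
    + intros [j Hj]. apply Hodd in Hj. apply NNPP. intro Hn.
      pose proof (Hp 0 j) as H. rewrite (Hy0 Hn) in H. pose proof (inv_pow2_pos j).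
      revert H. unfold Rabs. destruct Rcase_abs; lra.
Qed.

Lemma embeds_of_stages : computably_embeds (S_ A) hilbert_cube.
Proof.
  pose (y := fun n => proj1_sig (constructive_indefinite_description _ (image_exists n))).
  assert (Hy : forall n, image n (y n)) by (intro n; apply proj2_sig).
  pose (i := fun x : S_ A => (fun k => exist (fun r : R => (0 <= r <= 1)%R)
    (y (idx A x) k) (image_bounds _ _ (Hy (idx A x)) k)) : hilbert_cube).
  assert (Hname : forall x p, names p (i x) <-> cube_name (y (idx A x)) p)
    by (intros x p; reflexivity).
  assert (Hinj : forall x x', i x = i x' -> x = x').
  { intros x x' H. apply idx_inj.
    apply (f_equal (fun z : hilbert_cube => proj1_sig (z (S (idx A x))))) in H.
    cbn in H. rewrite (proj1 (Hy _)), (proj1 (Hy _)), Nat.eqb_refl in H.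
    destruct (Nat.eqb_spec (idx A x) (idx A x')); [trivial | lra]. }
  exists i. split; [exact Hinj|]. split.
  - destruct embed_code as [d Hd]. exists (code_map d).
    split; [apply code_map_computable|]. intros x q _ Hq. apply names_S_A in Hq.
    destruct (Hd q _ _ Hq (Hy _)) as (p & Hp & Hn). exists p, (i x).
    split; [exact Hp | split; [reflexivity | exact Hn]].
  - destruct inverse_code as [d Hd]. exists (code_map d).
    split; [apply code_map_computable|]. intros [z [x Hx]] p _ Hp.
    change (names p z) in Hp. rewrite <- Hx in Hp.
    destruct (Hd _ _ p (Hy _) Hp) as (q & Hq & Hn). exists q, x.
    split; [exact Hq | split; [exact Hx | now apply names_S_A]].
Qed.

End Embedding.

Lemma two_ce_embeds A : two_ce A -> computably_embeds (S_ A) hilbert_cube.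
Proof.
  intros (B & C & HB & HC & HA).
  apply ce_stage in HB. destruct HB as (b & Hb & HB).
  apply ce_stage in HC. destruct HC as (c & Hc & HC).
  apply (embeds_of_stages A b c Hb Hc). intro n. now rewrite HA, HB, HC.
Qed.

(** * From an embedding to a 2-c.e. description *)

Lemma embedding_codes A : computably_embeds (S_ A) hilbert_cube ->
  exists c d (y : nat -> nat -> R),
    (forall q n, is_name A q n ->
       exists p, (forall m, ev q c m (p m)) /\ cube_name (y n) p) /\
    (forall p n, cube_name (y n) p ->
       exists q, (forall m, ev p d m (q m)) /\ is_name A q n).
Proof.
  intros (i & Hinj & (G & [c Hc] & HG) & (H & [d Hd] & HH)).
  pose (x := fun n => proj1_sig (constructive_indefinite_description _ (idx_surj A n))).
  assert (Hx : forall n, idx A (x n) = n).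
  { intro n. unfold x. apply proj2_sig. }
  exists c, d, (fun n k => proj1_sig ((i (x n) : hilbert_cube) k)). split.
  - intros q n Hq. rewrite <- (Hx n) in Hq. apply names_S_A in Hq.
    destruct (HG (x n) q) as (p & z & Hp & Hz & Hn); [now exists (i (x n)) | exact Hq|].
    unfold single in Hz. subst z. exists p. split; [exact (Hc q p Hp) | exact Hn].
  - intros p n Hp.
    destruct (HH (exist _ (i (x n)) (ex_intro _ (x n) eq_refl)) p) as (q & x' & Hq & Hx' & Hn).
    + now exists (x n).
    + exact Hp.
    + unfold inverse_on_image in Hx'. cbn in Hx'. apply Hinj in Hx'. subst x'.
      exists q. split; [exact (Hd p q Hq)|]. rewrite <- (Hx n). now apply names_S_A.
Qed.

Lemma embeds_two_ce A : computably_embeds (S_ A) hilbert_cube -> two_ce A.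
Proof.
  intro HE. destruct (embedding_codes A HE) as (c & d & y & Hc & Hd).
  assert (HZ : Cf (fun _ v => if v =? 0 then 1 else 0)) by cf. destruct HZ as [cZ HZ].
  assert (HI : Cf (fun _ z => 2 * p2 z + 1)) by cf. destruct HI as [cI HI].
  (* [cZ] exchanges zero and nonzero, so this search halts exactly when the decoded name shows
     top. *)
  pose (w0 := Mu (Comp cZ (Comp d cI))).
  assert (Hodd : forall p q j, (forall m, ev p d m (q m)) ->
    ev p (Comp cZ (Comp d cI)) (pr 0 j) (if q (2 * j + 1) =? 0 then 1 else 0)).
  { intros p q j Hq. eapply ev_comp; [|apply HZ]. eapply ev_comp; [apply HI|].
    rewrite p2_pr. apply Hq. }
  assert (Hw0 : forall p q, (forall m, ev p d m (q m)) ->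
    ((exists v, ev p w0 0 v) <-> exists j, q (2 * j + 1) <> 0)).
  { intros p q Hq. split.
    - intros [v [Hv _]]. exists v. pose proof (ev_fun Hv (Hodd p q v Hq)) as H.
      destruct (Nat.eqb_spec (q (2 * v + 1)) 0); easy.
    - intros [j Hj].
      destruct (least_exists (fun j => negb (q (2 * j + 1) =? 0))) as [v [Hv Hl]].
      { exists j. apply Nat.eqb_neq in Hj. now rewrite Hj. }
      exists v. split.
      + pose proof (Hodd p q v Hq) as H.
        destruct (Nat.eqb_spec (q (2 * v + 1)) 0); [discriminate | exact H].
      + intros k Hk. exists 0. pose proof (Hodd p q k Hq) as H. specialize (Hl k Hk).
        destruct (Nat.eqb_spec (q (2 * k + 1)) 0); [exact H | discriminate]. }
  pose (c' := Comp c Snd).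
  assert (Hc' : forall o m v, ev o c' (pr 0 m) v <-> ev o c m v).
  { intros o m v. split; intro H.
    - exact (ev_comp_inv _ _ _ _ _ _ (ev_Snd _ _ _) H).
    - eapply ev_comp; [apply ev_Snd | exact H]. }
  (* The search runs on the output of [c], which may be partial when [point n 1] is not a name. *)
  destruct (halting_stage (rel c' w0)) as (b & Hb & Hbs).
  assert (Hpt : forall e, Cf (fun _ z => point (p1 z) e (p2 z))).
  { intro e. unfold point. cf. }
  pose (val := fun e n m t => run (point n e) (encode c) m t).
  assert (Hval : forall e n m t, Cf n -> Cf m -> Cf t ->
    Cf (fun o z => val e (n o z) (m o z) (t o z))).
  { intros e n m t Hn Hm Ht. unfold val.
    apply (Cf_run (fun o z => point (n o z) e)); trivial; [|cf].
    unfold point. pose proof (Cf_comp _ _ Hn (Cf_p1 _ Cf_id)). cf. }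
  (* [w] codes the coordinate [i], the precisions [j] and [k], and the running times. *)
  pose (conflict := fun n w =>
    let i := p1 w in let j := p1 (p2 w) in let k := p1 (p2 (p2 w)) in
    let u := val 1 n (pr i j) (p1 (p2 (p2 (p2 w)))) in
    let v := val 0 n (pr i k) (p2 (p2 (p2 (p2 w)))) in
    (negb (u =? 0) && (negb (v =? 0) &&
      (gap (Nat.pred u) j (Nat.pred v) k || gap (Nat.pred v) k (Nat.pred u) j)))%bool).
  exists (fun n => exists t, b (point n 1) (pr 0 0) t = true),
    (fun n => exists w, conflict n w = true).
  split; [|split].
  - apply ce_stage. exists (fun n => b (point n 1) (pr 0 0)). split; [|intro n; reflexivity].
    apply (Cf_app2 (fun _ n t => if b (point n 1) (pr 0 0) t then 1 else 0)); [|cf..].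
    assert (Hin : Cf (fun _ z => pr (pr 0 0) (p2 z))) by cf.
    pose proof (Cf_subst _ (fun _ n => point n 1) (fun _ z => p1 z) _ Hb (Hpt 1)
      (Cf_p1 _ Cf_id) Hin) as H.
    refine (Cf_ext _ _ H _). intros o x. cbv beta. now autorewrite with pair.
  - apply ce_stage. exists conflict. split; [|intro n; reflexivity].
    unfold conflict. cbv zeta.
    assert (Hu : Cf (fun _ z => val 1 (p1 z) (pr (p1 (p2 z)) (p1 (p2 (p2 z))))
                                  (p1 (p2 (p2 (p2 (p2 z))))))) by (apply Hval; cf).
    assert (Hv : Cf (fun _ z => val 0 (p1 z) (pr (p1 (p2 z)) (p1 (p2 (p2 (p2 z)))))
                                  (p2 (p2 (p2 (p2 (p2 z))))))) by (apply Hval; cf).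
    apply Cfb_andb; [cf|]. apply Cfb_andb; [cf|]. apply Cfb_orb; apply Cfb_gap; cf.
  - assert (Hbn : forall n, (exists t, b (point n 1) (pr 0 0) t = true) <->
      exists v, ev (point n 1) (rel c' w0) (pr 0 0) v).
    { intro n. symmetry. apply Hbs. }
    intro n. rewrite Hbn. split.
    + intro Hn. pose proof (is_name_top A n Hn) as Htop.
      destruct (Hc _ n Htop) as (p & Hp & Hpn). split.
      * destruct (Hd p n Hpn) as (q & Hq & [_ HqA]).
        destruct (proj2 (Hw0 p q Hq)) as [v Hv]; [now apply HqA|].
        exists v. apply (ev_rel _ c' p); [|exact Hv]. intro m. now apply Hc'.
      * intros [w Hw]. unfold conflict in Hw. cbv zeta in Hw.
        set (i := p1 w) in Hw. set (j := p1 (p2 w)) in Hw. set (k := p1 (p2 (p2 w))) in Hw.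
        apply andb_prop in Hw. destruct Hw as [Hu Hw].
        apply andb_prop in Hw. destruct Hw as [Hv Hw].
        unfold val in *.
        destruct (run (point n 1) _ _ _) as [|u] eqn:Eu; [discriminate|].
        destruct (run (point n 0) _ _ _) as [|v] eqn:Ev; [discriminate|].
        cbn [Nat.pred] in Hw. apply run_sound in Eu, Ev.
        (* The value found on [point n 0] is also found on a genuine name over [n]. Both values then
           approximate the same coordinate, which the gap forbids. *)
        destruct (ev_continuous _ _ _ _ Ev) as [l Hl].
        destruct (limit_agree A n l Hn) as (q & Hq & Hql).
        destruct (Hc q n Hq) as (p' & Hp' & Hpn').
        pose proof (Hpn i j) as H1. rewrite (ev_fun (Hp _) Eu) in H1.
        pose proof (Hpn' i k) as H2. rewrite (ev_fun (Hp' _) (Hl q Hql)) in H2.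
        apply Bool.orb_prop in Hw.
        rewrite !gap_spec in Hw. revert Hw H1 H2. unfold Rabs.
        repeat destruct Rcase_abs; intros [Hw|Hw]; lra.
    + intros [[v Hv] HC]. apply NNPP. intro Hn.
      destruct (Hc _ n (is_name_bot A n Hn)) as (p & Hp & Hpn).
      destruct (ev_rel_use _ _ _ _ _ _ Hv) as (L & HL & HLw).
      (* Without a conflict, every value computed on [point n 1] is within its tolerance of the true
         coordinate. Otherwise an approximation computed on the name [point n 0], with 2^-k below
         half the excess, would exhibit a gap. *)
      assert (Hclose : forall m u, ev (point n 1) c m u ->
        (Rabs (rational u - y n (p1 m)) <= / 2 ^ p2 m)%R).
      { intros m u Hu. apply Rnot_lt_le. intro Hfar.
        destruct (pow2_inv_small (e := ((Rabs (rational u - y n (p1 m)) - / 2 ^ p2 m) / 2)%R))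
          as [k Hk]; [lra|].
        destruct (run_complete _ _ _ _ Hu) as [t Ht].
        destruct (run_complete _ _ _ _ (Hp (pr (p1 m) k))) as [t' Ht'].
        apply HC. exists (pr (p1 m) (pr (p2 m) (pr k (pr t t')))).
        unfold conflict, val. autorewrite with pair. cbv zeta. rewrite pr_eta, Ht, Ht'.
        cbn [Nat.eqb negb andb Nat.pred]. apply Bool.orb_true_intro. rewrite !gap_spec.
        pose proof (Hpn (p1 m) k) as H. revert Hfar Hk H. unfold Rabs.
        repeat destruct Rcase_abs; intros; lra. }
      (* The sequence [r] built from this takes the values computed on [point n 1] where they exist
         and those of the true name [p] elsewhere. It is a name of the image of the point over [n]
         and agrees with every answer used in [Hv], so decoding it shows top and forces [n] into
         [A]. *)
      pose (P := fun m u => (Rabs (rational u - y n (p1 m)) <= / 2 ^ p2 m)%R /\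
        forall u', ev (point n 1) c m u' -> u = u').
      assert (HP : forall m, exists u, P m u).
      { intro m. destruct (classic (exists u, ev (point n 1) c m u)) as [[u Hu]|Hno].
        - exists u. split; [now apply Hclose|]. intros u' Hu'. exact (ev_fun Hu Hu').
        - exists (p m). split.
          + pose proof (Hpn (p1 m) (p2 m)) as H. now rewrite pr_eta in H.
          + intros u' Hu'. contradiction Hno. now exists u'. }
      destruct (baire_choice HP) as [r Hr].
      assert (Hrn : cube_name (y n) r).
      { intros i j. destruct (Hr (pr i j)) as [H _]. now autorewrite with pair in H. }
      destruct (Hd r n Hrn) as (q & Hq & [_ HqA]). apply Hn, HqA, (Hw0 r q Hq).
      exists v. apply HLw. intros m Hm. destruct (HL m Hm) as [u Hu].
      rewrite (proj2 (Hr m) u); [exact Hu | now apply Hc'].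
Qed.

Theorem proposition23 (A : nat -> Prop) :
  (computably_embeds (S_ A) hilbert_cube <-> computably_normal (S_ A)) /\
  (computably_normal (S_ A) <-> two_ce A).
Proof.
  pose proof (two_ce_embeds A). pose proof (embeds_two_ce A).
  pose proof (two_ce_normal A). pose proof (normal_two_ce A). tauto.
Qed.
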